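(* There exist uniform constants $0<\alpha,\beta<\infty$ (not depending on $n$, $p$, $c$) such that for every odd prime $p$, every integer $n\ge 2$, and every real $c>0$ for which $t=c\,\beta\,p\,n\log n$ is a positive integer, and for every starting point $x\in G$, $$4\,\|Q_x^{*t}-\mu\|_{T.V.}^2\le \alpha\, e^{-c}.$$
   Context: Let $p$ be an odd prime, $n\ge 2$, and let $G$ be the group of $n\times n$ upper triangular matrices with $1$'s on the diagonal and entries in $\mathbb{Z}/p\mathbb{Z}$ above the diagonal. Let $E(i,i+1)$ be the $n\times n$ matrix with a one in entry $(i,i+1)$ and zeros elsewhere, and $I_n$ the identity matrix. Let $a=\lfloor\sqrt p\rfloor$ if $\lfloor\sqrt p\rfloor$ is odd and $a=\lfloor\sqrt p\rfloor+1$ otherwise. For $1\le i\le n-1$ and $y\in\{1,-1,a,-a\}$, let $C_i(y)$ be the conjugacy class in $G$ of $I_n+yE(i,i+1)$; it has $p^{n-2}$ elements. The random walk $Q$ on $G$ has one-step transition probabilities $$Q_x(xg)=\frac{1}{4(n-1)p^{n-2}}\sum_{i=1}^{n-1}\ \sum_{y\in(1,-1,a,-a)}\mathbf 1[g\in C_i(y)],\qquad x,g\in G,$$ where the inner sum runs over the four-term list $1,-1,a,-a$ (with multiplicity). For $p\ge5$ these classes are pairwise disjoint, so $Q_x(xg)=\frac{1}{4(n-1)p^{n-2}}$ if $g$ lies in some $C_i(\pm1)\cup C_i(\pm a)$ and $Q_x(xg)=0$ otherwise. The $t$-step probabilities are defined inductively by $Q_x^{*1}=Q_x$ and $Q_x^{*t}(y)=\sum_{w\in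 G}Q_w^{*(t-1)}(y)Q_x(w)$. Here $\mu$ is the uniform probability measure on $G$, and the total variation distance is $$\|Q_x^{*t}-\mu\|_{T.V.}=\frac12\sum_{g\in G}|Q_x^{*t}(g)-\mu(g)|.$$ (Because the walk is invariant under left translation, this distance does not depend on $x$.) *)

(* Defs.v *)
From HB Require Import structures.
From mathcomp Require Import all_boot all_order all_algebra all_fingroup.
From mathcomp Require Import reals sequences exp.

Set Implicit Arguments.
Unset Strict Implicit.
Unset Printing Implicit Defensive.

Import Order.TTheory GRing.Theory Num.Theory.
Local Open Scope ring_scope.

Section Unitriangular.
Variables n p : nat.

(* The elements of {'GL_n(p)} are matrices of size n.-1.+1, which is n
   as soon as 0 < n; 'F_p is Z/pZ as soon as p is prime. *)
Definition UT_set : {set {'GL_n(p)}} :=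
  [set g : {'GL_n(p)} | [forall i : 'I_n.-1.+1, forall j : 'I_n.-1.+1,
    (j <= i)%N ==> (GLval g i j == (i == j)%:R)]].

Lemma UT_setP (g : {'GL_n(p)}) :
  reflect (forall i j : 'I_n.-1.+1, (j <= i)%N -> GLval g i j = (i == j)%:R)
          (g \in UT_set).
Proof.
rewrite inE; apply: (iffP forallP) => [gP i j le_ji | gP i].
  by have /forallP/(_ j)/implyP/(_ le_ji)/eqP := gP i.
by apply/forallP=> j; apply/implyP=> le_ji; apply/eqP/gP.
Qed.

Lemma UT_group_set : group_set UT_set.
Proof.
apply/group_setP; split=> [|g h /UT_setP gP /UT_setP hP].
  by apply/UT_setP=> i j _; rewrite GL_1E mxE.
apply/UT_setP=> i j le_ji; rewrite GL_MxE mxE (bigD1 i) //= gP // eqxx mul1r.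
rewrite hP // big1 ?addr0 // => k ne_ki.
case: (ltngtP k i) => [lt_ki | lt_ik | /val_inj eq_ki].
- by rewrite gP ?(ltnW lt_ki) // eq_sym (negPf ne_ki) mul0r.
- have lt_jk := leq_ltn_trans le_ji lt_ik.
  rewrite hP ?(ltnW lt_jk) //; case: eqP => [eq_kj|_]; last by rewrite mulr0.
  by rewrite eq_kj ltnn in lt_jk.
- by rewrite eq_ki eqxx in ne_ki.
Qed.

Canonical UT : {group {'GL_n(p)}} := Group UT_group_set.

(* Here i is 0-based: this is I_n + y E(i+1, i+2) in 1-based indexing, and
   i : 'I_n.-1 ranges over the n - 1 superdiagonal positions. *)
Definition elem_mx (i : 'I_n.-1) (y : 'F_p) : 'M['F_p]_n.-1.+1 :=
  1%:M + y *: delta_mx (widen_ord (leqnSn _) i) (lift ord0 i).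

Lemma elem_mx_unit i y : elem_mx i y \is a GRing.unit.
Proof.
set E := delta_mx (widen_ord (leqnSn _) i) (lift ord0 i) : 'M['F_p]_n.-1.+1.
have EE0 : E *m E = 0.
  apply: mul_delta_mx_0; apply/eqP=> /(congr1 val) /=.
  by rewrite /bump /= add1n => /eqP; rewrite gtn_eqF.
have defV : (1%:M - y *: E) *m elem_mx i y = 1%:M.
  rewrite /elem_mx -/E mulmxDr mulmx1 mulmxBl mul1mx -scalemxAl -scalemxAr.
  by rewrite EE0 !scaler0 subr0 subrK.
by have [_] := mulmx1_unit defV.
Qed.

Definition elem_UT (i : 'I_n.-1) (y : 'F_p) : {'GL_n(p)} :=
  FinRing.unit _ (elem_mx_unit i y).

Definition elem_class (i : 'I_n.-1) (y : 'F_p) : {set {'GL_n(p)}} :=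
  (elem_UT i y ^: UT)%g.

End Unitriangular.

Section Walk.
Variables (R : realType) (n p : nat).

(* The number called a: the one of floor(sqrt p), floor(sqrt p) + 1 that is
   odd. *)
Definition jump : nat :=
  let m := Num.truncn (Num.sqrt (p%:R : R)) in if odd m then m else m.+1.

Definition jumps : seq 'F_p := [:: 1; -1; jump%:R; - jump%:R].

(* walk_step x w is Q_x(w), with w = x g, that is g = x^-1 w. *)
Definition walk_step (x w : {'GL_n(p)}) : R :=
  (4 * n.-1%:R * p%:R ^+ (n - 2))^-1 *
  \sum_(i < n.-1) \sum_(y <- jumps) ((x^-1 * w)%g \in elem_class i y)%:R.

(* walk t x w is the t-step probability Q_x^{*t}(w) for t > 0, starting from
   Q^{*1} = Q; the value at t = 0 is irrelevant. *)
Definition walk (t : nat) : {'GL_n(p)} -> {'GL_n(p)} -> R :=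
  iter t.-1 (fun K x y => \sum_(w in UT n p) K w y * walk_step x w) walk_step.

Definition unif (g : {'GL_n(p)}) : R := (#|UT n p|%:R)^-1.

Definition tv_dist (P P' : {'GL_n(p)} -> R) : R :=
  2^-1 * \sum_(g in UT n p) `|P g - P' g|.

End Walk.

(* Main.v *)
Require Import Defs.
From HB Require Import structures.
From mathcomp Require Import all_boot all_order all_algebra all_fingroup.
From mathcomp Require Import ring lra zify.
From mathcomp Require Import reals sequences exp.

(** Let G be the unitriangular group, m = n - 1 the number of superdiagonal
   positions, and work in the group algebra of G with the l1 norm, where the
   t-step law of the walk is the power q ^+ t of the one-step law q, so that
   twice the total variation distance to the uniform law U is the l1 norm of
   q ^+ t - U. The law q is the average of m laws s_0, ..., s_(m-1), where
   s_i is the average of the uniform laws of four conjugacy classes sitting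
   at position i; all of these are class functions on G and commute.

   The distance splits into a part living on the commutator subgroup G' and
   a part living on the abelian quotient G / G'. Let pi be the uniform law
   of G'.

   - If every position has been used, nothing is left of the first part:
     the product of s_0, ..., s_(m-1) is annihilated by 1 - pi
     ([coord_prod_pi]). The reason is a tower of normal subgroups K_0 = 1,
     ..., K_m = G', where K_i consists of the matrices of G' that differ
     from the identity in the first i rows only: modulo K_i, the conjugacy
     class of x = I + y E(i,i+1) is the full coset x K_(i+1)
     ([class_corner_step]), so that the class law times the law of K_i
     already absorbs K_(i+1). A coupon-collector argument
     ([coupon_collector]) then bounds the norm of q ^+ t (1 - pi) by
     2 m (1 - 1/m) ^+ t.

   - On G / G' the walk picks a coordinate and moves it by 1, -1, a or -a in
     Z/pZ. Since a is of the order of the square root of p, each residue is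
     of the form 2 r + 2 a s with r and s of the order of sqrt p, and a
     shift by 2 or by 2 a changes the law of N steps of the one-coordinate
     walk by O(1 / sqrt N) in norm ([l1_walk_derivative]). So for a suitable
     N of the order of p, all shifts change that law by at most 1/2
     ([four_step_half]), which gives exponential decay at rate 1/p in the
     number of moves of the coordinate ([l1_block_decay]). A coordinate
     moves with probability 1/m at each step, so the rate is 1/(p m) for the
     whole walk ([l1_expD_comm], [step_decay]); summing over the m
     coordinates costs a factor m.

   Both parts are O(m exp (- t / O(p m))) ([step_law_bound]), and the factor
   m is absorbed by the logarithm in t = c beta p n ln n when c >= 1; for
   c < 1 the claim is trivial. *)

Set Implicit Arguments.
Unset Strict Implicit.
Unset Printing Implicit Defensive.

Import Order.TTheory GRing.Theory Num.Theory.
Local Open Scope ring_scope.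

(** * The group algebra of a finite group, with the l1 norm *)
Section GroupAlgebra.
Variables (R : realFieldType) (gT : finGroupType).

(** A fresh name for the functions on the group, which carry the pointwise
   product, so as to give them the convolution product. *)
Definition galg := {ffun gT -> R}.
HB.instance Definition _ := GRing.Zmodule.copy galg {ffun gT -> R}.
Implicit Types (f h : galg) (x y g : gT).

Definition galg_one : galg := [ffun x => (x == 1%g)%:R].
Definition galg_mul f h : galg := [ffun x => \sum_y f y * h (y^-1 * x)%g].

Lemma galg_mulA : associative galg_mul.
Proof.
move=> f1 f2 f3; apply/ffunP=> x; rewrite !ffunE.
under eq_bigr do rewrite ffunE big_distrr.
under [RHS]eq_bigr do rewrite ffunE big_distrl.
rewrite [RHS]exchange_big; apply: eq_bigr => y _.
rewrite [RHS](reindex_inj (mulgI y)); apply: eq_bigr => z _ /=.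
by rewrite mulrA mulKg invMg mulgA.
Qed.

Lemma galg_mul1l : left_id galg_one galg_mul.
Proof.
move=> f; apply/ffunP=> x; rewrite ffunE (bigD1 1%g) //= ffunE eqxx mul1r.
rewrite invg1 mul1g big1 ?addr0 // => y /negPf ne_y1.
by rewrite ffunE ne_y1 mul0r.
Qed.

Lemma galg_mul1r : right_id galg_one galg_mul.
Proof.
move=> f; apply/ffunP=> x; rewrite ffunE (bigD1 x) //= ffunE mulVg eqxx mulr1.
rewrite big1 ?addr0 // => y ne_yx; rewrite ffunE.
by rewrite -(inj_eq (mulgI y)) mulKVg mulg1 eq_sym (negPf ne_yx) mulr0.
Qed.

Lemma galg_mulDl : left_distributive galg_mul +%R.
Proof.
move=> f1 f2 f3; apply/ffunP=> x; rewrite !ffunE -big_split.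
by apply: eq_bigr => y _; rewrite /= ffunE mulrDl.
Qed.

Lemma galg_mulDr : right_distributive galg_mul +%R.
Proof.
move=> f1 f2 f3; apply/ffunP=> x; rewrite !ffunE -big_split.
by apply: eq_bigr => y _; rewrite /= ffunE mulrDr.
Qed.

Lemma galg_oner_neq0 : galg_one != 0.
Proof.
apply/eqP=> /ffunP/(_ 1%g)/eqP.
by rewrite ffunE ffunE eqxx (negPf (oner_neq0 R)).
Qed.

HB.instance Definition _ := GRing.Zmodule_isNzRing.Build galg
  galg_mulA galg_mul1l galg_mul1r galg_mulDl galg_mulDr galg_oner_neq0.

Definition galg_scale (a : R) f : galg := [ffun x => a * f x].

Lemma galg_scaleA a b f :
  galg_scale a (galg_scale b f) = galg_scale (a * b) f.
Proof. by apply/ffunP=> x; rewrite !ffunE mulrA. Qed.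
Lemma galg_scale1 : left_id 1 galg_scale.
Proof. by move=> f; apply/ffunP=> x; rewrite ffunE mul1r. Qed.
Lemma galg_scaleDr : right_distributive galg_scale +%R.
Proof. by move=> a f h; apply/ffunP=> x; rewrite !ffunE mulrDr. Qed.
Lemma galg_scaleDl f : {morph galg_scale^~ f : a b / a + b}.
Proof. by move=> a b; apply/ffunP=> x; rewrite !ffunE mulrDl. Qed.

HB.instance Definition _ := GRing.Zmodule_isLmodule.Build R galg
  galg_scaleA galg_scale1 galg_scaleDr galg_scaleDl.

Lemma galg_scaleAl (a : R) f h : a *: (f * h) = (a *: f) * h.
Proof.
apply/ffunP=> x; rewrite !ffunE big_distrr; apply: eq_bigr => y _ /=.
by rewrite ffunE mulrA.
Qed.

HB.instance Definition _ := GRing.Lmodule_isLalgebra.Build R galg galg_scaleAl.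

Lemma galg_scaleAr (a : R) f h : a *: (f * h) = f * (a *: h).
Proof.
apply/ffunP=> x; rewrite !ffunE big_distrr; apply: eq_bigr => y _ /=.
by rewrite ffunE mulrCA.
Qed.

HB.instance Definition _ := GRing.Lalgebra_isAlgebra.Build R galg galg_scaleAr.

Lemma galg_mulE f h x : (f * h) x = \sum_y f y * h (y^-1 * x)%g.
Proof. by rewrite ffunE. Qed.

Lemma galg_scaleE a f x : (a *: f) x = a * f x.
Proof. by rewrite ffunE. Qed.

Lemma galg_sumE I (r : seq I) (P : pred I) (F : I -> galg) x :
  (\sum_(i <- r | P i) F i) x = \sum_(i <- r | P i) F i x.
Proof.
by apply: (big_morph (fun f : galg => f x)) => [f h|]; rewrite ffunE.
Qed.

Definition dirac g : galg := [ffun x => (x == g)%:R].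
Definition l1 f : R := \sum_x `|f x|.
Definition mass f : R := \sum_x f x.
Definition unifm (A : {set gT}) : galg :=
  [ffun x => (x \in A)%:R / #|A|%:R].

Lemma commrZ (a b : R) f h :
  GRing.comm f h -> GRing.comm (a *: f) (b *: h).
Proof.
by move=> cfh; rewrite /GRing.comm -!scalerAl -!scalerAr cfh scalerA mulrC -scalerA.
Qed.

Lemma dirac1 : dirac 1%g = 1. Proof. by []. Qed.

Lemma diracMl g f x : (dirac g * f) x = f (g^-1 * x)%g.
Proof.
rewrite galg_mulE (bigD1 g) //= ffunE eqxx mul1r big1 ?addr0 // => y /negPf ne.
by rewrite ffunE ne mul0r.
Qed.

Lemma diracMr g f x : (f * dirac g) x = f (x * g^-1)%g.
Proof.
rewrite galg_mulE (bigD1 (x * g^-1)%g) //= ffunE invMg invgK -mulgA mulVg mulg1.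
rewrite eqxx mulr1 big1 ?addr0 // => y ne; rewrite ffunE.
case: eqP => [E|]; last by rewrite mulr0.
by move: ne; rewrite -E invMg invgK mulgA mulgV mul1g eqxx.
Qed.

Lemma diracM g x : dirac g * dirac x = dirac (g * x)%g.
Proof.
by apply/ffunP=> y; rewrite diracMl !ffunE -(inj_eq (mulgI g)) mulKVg.
Qed.

Lemma galg_sum_dirac f : f = \sum_g f g *: dirac g.
Proof.
apply/ffunP=> x; rewrite sum_ffunE (bigD1 x) //= !ffunE eqxx mulr1.
by rewrite big1 ?addr0 // => y ne; rewrite !ffunE eq_sym (negPf ne) mulr0.
Qed.

Lemma l1_ge0 f : 0 <= l1 f. Proof. exact: sumr_ge0. Qed.
Lemma l1_0 : l1 0 = 0. Proof. by apply: big1 => x _; rewrite ffunE normr0. Qed.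
Lemma l1D f h : l1 (f + h) <= l1 f + l1 h.
Proof. by rewrite -big_split ler_sum // => x _; rewrite ffunE ler_normD. Qed.
Lemma l1Z a f : l1 (a *: f) = `|a| * l1 f.
Proof. by rewrite /l1 big_distrr; apply: eq_bigr => x _; rewrite ffunE normrM. Qed.
Lemma l1N f : l1 (- f) = l1 f.
Proof. by apply: eq_bigr => x _; rewrite ffunE normrN. Qed.
Lemma l1_sum I (r : seq I) (P : pred I) (F : I -> galg) :
  l1 (\sum_(i <- r | P i) F i) <= \sum_(i <- r | P i) l1 (F i).
Proof.
elim/big_rec2: _ => [|i a f _ IH]; first by rewrite l1_0.
by apply: le_trans (l1D _ _) _; rewrite lerD2l.
Qed.

Lemma l1_dirac g : l1 (dirac g) = 1.
Proof.
rewrite /l1 (bigD1 g) //= ffunE eqxx normr1 big1 ?addr0 // => x /negPf ne.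
by rewrite ffunE ne normr0.
Qed.

Lemma l1M f h : l1 (f * h) <= l1 f * l1 h.
Proof.
have hE g : l1 (dirac g * h) = l1 h.
  rewrite [RHS](reindex_inj (mulgI g^-1%g)).
  by apply: eq_bigr => x _; rewrite diracMl.
rewrite {1}[f]galg_sum_dirac mulr_suml; apply: le_trans (l1_sum _ _ _) _.
by rewrite big_distrl ler_sum // => g _; rewrite -scalerAl l1Z hE.
Qed.

Lemma l1M1 f h : l1 f <= 1 -> l1 (f * h) <= l1 h.
Proof.
by move=> f1; apply: le_trans (l1M _ _) _; rewrite ler_piMl // l1_ge0.
Qed.
Lemma l1M1r f h : l1 h <= 1 -> l1 (f * h) <= l1 f.
Proof.
by move=> f1; apply: le_trans (l1M _ _) _; rewrite ler_piMr // l1_ge0.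
Qed.
Lemma l1X f k : l1 f <= 1 -> l1 (f ^+ k) <= 1.
Proof.
move=> f1; elim: k => [|k IH]; first by rewrite expr0 -dirac1 l1_dirac.
by rewrite exprS; apply: le_trans (l1M1 _ f1) IH.
Qed.

Lemma massD f h : mass (f + h) = mass f + mass h.
Proof. by rewrite -big_split; apply: eq_bigr => x _; rewrite ffunE. Qed.
Lemma mass_sum I (r : seq I) (P : pred I) (F : I -> galg) :
  mass (\sum_(i <- r | P i) F i) = \sum_(i <- r | P i) mass (F i).
Proof.
by apply: (big_morph _ massD); apply: big1 => x _; rewrite ffunE.
Qed.
Lemma massM f h : mass (f * h) = mass f * mass h.
Proof.
rewrite /mass; under eq_bigr do rewrite galg_mulE.
rewrite exchange_big big_distrl; apply: eq_bigr => g _ /=.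
rewrite -big_distrr [in RHS](reindex_inj (mulgI g^-1%g)) //.
Qed.

Definition supp (X : {set gT}) f := forall x, x \notin X -> f x = 0.
Implicit Type X : {set gT}.

Lemma suppE X f : supp X f -> f = \sum_(g in X) f g *: dirac g.
Proof.
move=> Xf; rewrite {1}[f]galg_sum_dirac (bigID (mem X)) /=.
by rewrite [X in _ + X]big1 ?addr0 // => g /Xf ->; rewrite scale0r.
Qed.

Lemma mass_supp X f : supp X f -> mass f = \sum_(g in X) f g.
Proof.
move=> Xf; rewrite /mass (bigID (mem X)) /=.
by rewrite [X in _ + X]big1 ?addr0 // => g /Xf ->.
Qed.

Lemma supp_dirac X g : g \in X -> supp X (dirac g).
Proof. by move=> Xg x; rewrite ffunE; case: eqP => // ->; rewrite Xg. Qed.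

Lemma suppZ X a f : supp X f -> supp X (a *: f).
Proof. by move=> Xf x /Xf f0; rewrite ffunE f0 mulr0. Qed.

Lemma suppD X f h : supp X f -> supp X h -> supp X (f + h).
Proof. by move=> Xf Xh x Xx; rewrite ffunE Xf ?Xh ?addr0. Qed.

Lemma suppB X f h : supp X f -> supp X h -> supp X (f - h).
Proof. by move=> Xf Xh x Xx; rewrite !ffunE Xf ?Xh ?subr0. Qed.

Lemma supp_sum X I (r : seq I) (P : pred I) (F : I -> galg) :
  (forall i, P i -> supp X (F i)) -> supp X (\sum_(i <- r | P i) F i).
Proof.
by move=> XF; elim/big_ind: _ => //; [move=> x _; rewrite ffunE | exact: suppD].
Qed.

Lemma suppM (G : {group gT}) f h : supp G f -> supp G h -> supp G (f * h).
Proof.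
move=> Gf Gh x Gx; rewrite galg_mulE big1 // => y _.
have [Gy|/Gf->] := boolP (y \in G); last by rewrite mul0r.
by rewrite Gh ?mulr0 // groupMl ?groupV.
Qed.

Lemma supp1 (G : {group gT}) : supp G 1.
Proof. exact/supp_dirac/group1. Qed.

Lemma suppX (G : {group gT}) f k : supp G f -> supp G (f ^+ k).
Proof.
move=> Gf; elim: k => [|k IH]; first exact: supp1.
by rewrite exprS; apply: suppM.
Qed.

Lemma supp_sub (X Y : {set gT}) f : X \subset Y -> supp X f -> supp Y f.
Proof. by move=> sXY Xf x Yx; apply: Xf; apply: contra Yx; apply: (subsetP sXY). Qed.

Lemma supp_unifm X : supp X (unifm X).
Proof. by move=> x Xx; rewrite ffunE (negPf Xx) mul0r. Qed.

Lemma supp_mull X f z w : supp X f -> mass f = 1 ->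
  {in X, forall g, z * dirac g = w} -> z * f = w.
Proof.
move=> Xf f1 zX; rewrite (suppE Xf) mulr_sumr.
under eq_bigr => g Xg do rewrite -scalerAr zX //.
by rewrite -scaler_suml -(mass_supp Xf) f1 scale1r.
Qed.

Lemma supp_mulr X f z w : supp X f -> mass f = 1 ->
  {in X, forall g, dirac g * z = w} -> f * z = w.
Proof.
move=> Xf f1 zX; rewrite (suppE Xf) mulr_suml.
under eq_bigr => g Xg do rewrite -scalerAl zX //.
by rewrite -scaler_suml -(mass_supp Xf) f1 scale1r.
Qed.

Lemma supp_comm X f z :
  supp X f -> {in X, forall g, GRing.comm z (dirac g)} -> GRing.comm z f.
Proof.
move=> Xf zX; rewrite (suppE Xf); apply: commr_sum => g Xg.
by rewrite /GRing.comm -scalerAr zX // scalerAl.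
Qed.

(** A combination of mass zero of group elements g is a combination of the
   differences g - 1, so the effect of z on it is controlled by how much z
   changes under translation. *)
Lemma l1_mull_mass0 X f z e : supp X f -> mass f = 0 ->
    {in X, forall g, l1 (z * (1 - dirac g)) <= e} -> l1 (z * f) <= e * l1 f.
Proof.
move=> Xf f0 ze.
have -> : z * f = \sum_(g in X) - f g *: (z * (1 - dirac g)).
  under eq_bigr do rewrite mulrBr mulr1 scalerBr !scaleNr opprK addrC.
  rewrite sumrB -scaler_suml -mass_supp // f0 scale0r subr0.
  by rewrite {1}(suppE Xf) mulr_sumr; apply: eq_bigr => g _; rewrite scalerAr.
apply: le_trans (l1_sum _ _ _) _; rewrite mulrC /l1 big_distrl /=.
rewrite [leRHS](bigID (mem X)) /= [X in _ <= _ + X]big1 ?addr0 => [|g /Xf ->].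
  by apply: ler_sum => g Xg; rewrite -/(l1 _) l1Z normrN ler_wpM2l ?ze.
by rewrite normr0 mul0r.
Qed.

Lemma mass_unifm X x : x \in X -> mass (unifm X) = 1.
Proof.
move=> Xx; rewrite (mass_supp (@supp_unifm X)).
under eq_bigr => g Xg do rewrite ffunE Xg mul1r.
rewrite sumr_const -[_ *+ _]mulr_natl divff // pnatr_eq0 -lt0n.
by apply/card_gt0P; exists x.
Qed.

Lemma l1_unifm X x : x \in X -> l1 (unifm X) = 1.
Proof.
move=> Xx; rewrite -(mass_unifm Xx); apply: eq_bigr => g _.
by rewrite ffunE ger0_norm // divr_ge0 ?ler0n.
Qed.

Lemma l1_1 : l1 1 = 1. Proof. exact: l1_dirac. Qed.
Lemma mass_dirac g : mass (dirac g) = 1.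
Proof.
rewrite /mass (bigD1 g) //= ffunE eqxx big1 ?addr0 // => x /negPf ne.
by rewrite ffunE ne.
Qed.

Lemma massN f : mass (- f) = - mass f.
Proof. by rewrite -sumrN; apply: eq_bigr => x _; rewrite ffunE. Qed.
Lemma massZ a f : mass (a *: f) = a * mass f.
Proof. by rewrite /mass big_distrr; apply: eq_bigr => x _; rewrite ffunE. Qed.

Lemma unifm_mulr (H : {group gT}) g : g \in H -> unifm H * dirac g = unifm H.
Proof.
by move=> Hg; apply/ffunP=> x; rewrite diracMr !ffunE groupMr ?groupV.
Qed.
Lemma unifm_mull (H : {group gT}) g : g \in H -> dirac g * unifm H = unifm H.
Proof.
by move=> Hg; apply/ffunP=> x; rewrite diracMl !ffunE groupMl ?groupV.
Qed.

Lemma unifm_comm X g : (X :^ g = X)%g -> GRing.comm (unifm X) (dirac g).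
Proof.
move=> Xg; apply/ffunP=> x; rewrite diracMr diracMl !ffunE; congr (_%:R / _).
by rewrite -{2}Xg mem_conjg conjgE invgK mulgA mulKVg.
Qed.

(** The product of the uniform laws of the class of x and of K is invariant
   under conjugation by G and under K, hence constant on x ^: G * K. The
   hypothesis makes this set invariant under H, so that the product is
   invariant under H as well. *)
Lemma unifm_class_absorb (G K H : {group gT}) x :
    K \subset G -> H \subset G -> (G \subset 'N(K))%g -> (G \subset 'N(H))%g ->
    {in H, forall h : gT, (x * h)%g \in (x ^: G * K)%g} ->
  {in H, forall h : gT, unifm (x ^: G)%g * unifm K * dirac h =
    unifm (x ^: G)%g * unifm K}.
Proof.
move=> sKG sHG nKG nHG xH.
set f := unifm (x ^: G)%g * unifm K; set X := (x ^: G * K)%g in xH.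
have Xx : x \in X by rewrite -[x]mulg1 mem_mulg ?class_refl.
have fK w k : k \in K -> f (w * k)%g = f w.
  move=> Kk; have fkV : f * dirac k^-1%g = f.
    by rewrite /f -mulrA unifm_mulr ?groupV.
  by rewrite -[in RHS]fkV diracMr invgK.
have nX g : g \in G -> ((x ^: G) :^ g = x ^: G)%g.
  by move=> Gg; apply/normP; apply: (subsetP (class_norm x G)).
have fJ w g : g \in G -> f (w ^ g)%g = f w.
  move=> Gg; have : GRing.comm (dirac g) f.
    apply: commrM; apply/commr_sym/unifm_comm; first exact: nX.
    by apply/normP; apply: (subsetP nKG).
  move=> /ffunP/(_ (w * g)%g); rewrite diracMl diracMr mulgK conjgE.
  by [].
have fX w : w \in X -> f w = f x.
  by case/mulsgP=> _ k /imsetP[g Gg ->] Kk ->; rewrite fK // fJ.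
have f0 w : w \notin X -> f w = 0.
  move=> Xw; rewrite galg_mulE big1 // => y _; rewrite !ffunE.
  case: (boolP (y \in _)) => [yX|]; last by rewrite !mul0r.
  case: (boolP ((y^-1 * w)%g \in K)) => [yK|]; last by rewrite mul0r mulr0.
  by case/negP: Xw; rewrite -[w](mulKVg y) mem_mulg.
have XP w : w \in X -> exists g k : gT, [/\ g \in G, k \in K & w = (x ^ g * k)%g].
  by case/mulsgP=> _ k /imsetP[g Gg ->] Kk ->; exists g, k.
have XH w (h : gT) : h \in H -> w \in X -> (w * h)%g \in X.
  move=> Hh /XP[g [k [Gg Kk ->]]].
  have Gk := subsetP sKG k Kk.
  have Hh' : ((h ^ k^-1) ^ g^-1)%g \in H.
    have kN := subsetP nHG _ (groupVr Gk).
    have gN := subsetP nHG _ (groupVr Gg).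
    by rewrite (memJ_norm _ gN) (memJ_norm _ kN).
  have [g2 [k2 [Gg2 Kk2 E]]] := XP _ (xH _ Hh').
  have -> : (x ^ g * k * h = x ^ (g2 * g) * (k2 ^ g * k))%g.
    rewrite conjgM mulgA -conjMg -E conjMg conjgKV -!mulgA; congr (_ * _)%g.
    by rewrite invgK mulVg mulg1.
  apply: mem_mulg; first by apply/imsetP; exists (g2 * g)%g; rewrite ?groupM.
  by rewrite groupM // memJ_norm //; apply: (subsetP nKG).
move=> h Hh; apply/ffunP=> w; rewrite diracMr.
have [Xw|Xw] := boolP (w \in X); first by rewrite !fX // XH ?groupV.
rewrite !f0 //; apply: contra Xw => Xwh.
by rewrite -[w](mulgKV h) XH.
Qed.

End GroupAlgebra.

(** * Norms of powers in the group algebra *)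
Section Estimates.
Variables (R : realFieldType) (gT : finGroupType).
Local Notation A := (galg R gT).

(** This is the expansion of (a + b) ^+ t by the binomial formula, done one
   factor at a time: it turns a decay rate for one coordinate into a decay
   rate for the walk that moves this coordinate at random times. *)
Lemma l1_expD_comm (a b z : A) (C al be : R) (t : nat) :
    GRing.comm a b -> l1 b <= be ->
    (forall k, l1 (a ^+ k * z) <= C * al ^+ k) ->
  l1 ((a + b) ^+ t * z) <= C * (al + be) ^+ t.
Proof.
move=> cab bB; elim: t C z => [|t IH] C z az.
  by have := az 0%N; rewrite !expr0.
rewrite exprSr -mulrA mulrDl mulrDr; apply: le_trans (l1D _ _) _.
rewrite exprS [leRHS]mulrA [C * _]mulrDr mulrDl lerD //; apply: IH => k.
  by rewrite mulrA -exprSr -mulrA -exprS.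
have -> : a ^+ k * (b * z) = b * (a ^+ k * z).
  by rewrite !mulrA; congr (_ * _); apply/esym/commrX.
apply: le_trans (l1M _ _) _; rewrite -mulrA mulrCA.
by rewrite ler_pM ?l1_ge0.
Qed.

Lemma prod_comm_rem (I : eqType) (s : I -> A) (r : seq I) i :
    (forall i j, GRing.comm (s i) (s j)) -> i \in r ->
  \prod_(j <- r) s j = (\prod_(j <- rem i r) s j) * s i.
Proof.
move=> cs; elim: r => //= j r IH.
have [->|ne_ji] := eqVneq j i.
  by move=> _; rewrite big_cons; apply: commr_prod.
by rewrite inE eq_sym (negPf ne_ji) /= => /IH E; rewrite !big_cons E mulrA.
Qed.

(** The sequence r lists the coupons still to be collected: z already
   contains the others, and nothing is left of z once all of r has been
   used. Choosing a coupon of r shortens r, choosing another one leaves the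
   situation unchanged; the factor size r is the union bound. *)
Lemma coupon_collector (m : nat) (s : 'I_m -> A) t (r : seq 'I_m) (z : A) :
    (0 < m)%N ->
    (forall i j, GRing.comm (s i) (s j)) -> (forall i, l1 (s i) <= 1) ->
    uniq r -> (\prod_(i <- r) s i) * z = 0 ->
  l1 ((m%:R^-1 *: \sum_i s i) ^+ t * z) <=
    (size r)%:R * (1 - m%:R^-1) ^+ t * l1 z.
Proof.
move=> m_gt0 cs s1; have m0 : m%:R != 0 :> R by rewrite pnatr_eq0 -lt0n.
have q0 : 0 <= 1 - m%:R^-1 :> R by rewrite subr_ge0 invf_le1 ?ltr0n ?ler1n.
elim: t r z => [|t IH] r z Ur.
  case: r Ur => [_|i r _ _] /=.
    by rewrite big_nil expr0 !mul1r => ->; rewrite l1_0 mulr0.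
  by rewrite !expr0 mul1r mulr1 ler_peMl ?l1_ge0 // ler1n.
move=> rz; set q := _ *: _; rewrite exprSr -mulrA {2}/q -scalerAl mulr_suml.
rewrite -scalerAr mulr_sumr l1Z ger0_norm ?invr_ge0 ?ler0n //.
rewrite ler_pdivrMl ?ltr0n //; apply: le_trans (l1_sum _ _ _) _.
have bnd i : l1 (q ^+ t * (s i * z)) <=
    ((size r)%:R - (i \in r)%:R) * (1 - m%:R^-1) ^+ t * l1 z.
  have szl : l1 (s i * z) <= l1 z by apply: l1M1.
  have [ri|r'i] := boolP (i \in r).
    have := IH (rem i r) (s i * z) (rem_uniq _ Ur).
    rewrite mulrA -prod_comm_rem // => /(_ rz) le1; apply: le_trans le1 _.
    have -> : (size r)%:R - true%:R = (size (rem i r))%:R :> R.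
      rewrite size_rem // -subn1 natrB //.
      by case: (r) ri.
    by rewrite ler_wpM2l // mulr_ge0 ?exprn_ge0.
  rewrite subr0; apply: le_trans (IH r _ Ur _) _.
    have : GRing.comm (s i) (\prod_(j <- r) s j) by apply: commr_prod.
    by rewrite mulrA => <-; rewrite -mulrA rz mulr0.
  by rewrite ler_wpM2l // mulr_ge0 ?exprn_ge0.
apply: le_trans (ler_sum _ (fun i _ => bnd i)) _.
rewrite -2!big_distrl /=.
have -> : \sum_(i < m) ((size r)%:R - (i \in r)%:R) =
    m%:R * (size r)%:R - (size r)%:R :> R.
  rewrite sumrB sumr_const card_ord -[_ *+ _]mulr_natl; congr (_ - _).
  rewrite -[in RHS](card_uniqP Ur) -sum1_card natr_sum [RHS]big_mkcond.
  by apply: eq_bigr => i _; case: (i \in r).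
rewrite exprS le_eqVlt; apply/orP; left; apply/eqP; field; exact: m0.
Qed.

(** Let S be the number of letters a minus the number of letters b in a
   random word of length N over a, b, c, d. Then N q ^+ N.-1 (a - b) / 4 is
   the expectation of S times the word, because a derivation that sends a to
   a, b to - b, c and d to 0 acts on q ^+ N. The norm is therefore at most the
   mean of |S|, and |S| is at most (S^2 + tau^2) / (2 tau) where S has variance
   N / 2. The shift s is what makes this an induction on N. *)
Lemma l1_walk_derivative (a b c d : A) (tau s : R) (N : nat) :
    0 < tau -> GRing.comm a b -> GRing.comm a c -> GRing.comm a d ->
    GRing.comm b c -> GRing.comm b d ->
    l1 a <= 1 -> l1 b <= 1 -> l1 c <= 1 -> l1 d <= 1 ->
  let q := 4^-1 *: (a + b + c + d) in
  l1 (N%:R *: (q ^+ N.-1 * (4^-1 *: (a - b))) + s *: q ^+ N) <=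
    (s ^+ 2 + N%:R / 2 + tau ^+ 2) / (2 * tau).
Proof.
move=> t0 cab cac cad cbc cbd a1 b1 c1 d1; set q := _ *: (a + b + c + d); rewrite /=.
have tau2 : 0 < 2 * tau by rewrite mulr_gt0.
set e := _ *: (a - b).
have ceq : GRing.comm e q.
  have cS x : GRing.comm x a -> GRing.comm x b -> GRing.comm (a - b) x.
    by move=> cxa cxb; apply/commr_sym; apply: commrB.
  have cD : GRing.comm (a - b) (a + b + c + d).
    by do 3?apply: commrD; apply: cS => //; exact: commr_sym.
  by rewrite /GRing.comm -!scalerAl -!scalerAr cD.
elim: N s => [|N IH] s.
  rewrite scale0r add0r expr0 l1Z l1_1 mulr1 mul0r addr0 ler_pdivlMr //.
  have: 0 <= (`|s| - tau) ^+ 2 by exact: sqr_ge0.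
  by rewrite -[s ^+ 2]real_normK ?num_real //; nra.
set X := fun s => N%:R *: (q ^+ N.-1 * e) + s *: q ^+ N in IH.
have -> : N.+1%:R *: (q ^+ N.+1.-1 * e) + s *: q ^+ N.+1 =
   4^-1 *: (a * X (s + 1) + b * X (s - 1) + c * X s + d * X s).
  have XD u : X (s + u) = X s + u *: q ^+ N by rewrite /X scalerDl addrA.
  rewrite !XD scale1r scaleN1r mulrDr mulrBr.
  transitivity (4^-1 *: ((a + b + c + d) * X s + (a - b) * q ^+ N)).
    rewrite [RHS]scalerDr [X in _ = X + _]scalerAl [X in _ = _ + X]scalerAl.
    rewrite -/q -/e (commrX N ceq) mulrDr.
    rewrite -!scalerAr mulrA -!exprS -natr1 scalerDl scale1r.
    suff -> : N%:R *: (4^-1 *: (q ^+ N.-1.+1 * (a - b))) =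
        N%:R *: (4^-1 *: (q ^+ N.+1.-1 * (a - b))).
      by rewrite addrAC.
    by case: (N) => // ; rewrite !scale0r.
  congr (_ *: _); rewrite !mulrDl mulNr.
  by rewrite [RHS](AC (2*2*1*1) ((1*3*5*6)*(2*4))).
rewrite l1Z ger0_norm ?invr_ge0 //.
have H x s' : l1 x <= 1 -> l1 (x * X s') <=
  (s' ^+ 2 + N%:R / 2 + tau ^+ 2) / (2 * tau).
  by move=> x1; apply: le_trans (l1M1 _ x1) (IH _).
have L : l1 (a * X (s + 1) + b * X (s - 1) + c * X s + d * X s) <=
  l1 (a * X (s + 1)) + l1 (b * X (s - 1)) + l1 (c * X s) + l1 (d * X s).
  apply: le_trans (l1D _ _) _; rewrite lerD2r.
  apply: le_trans (l1D _ _) _; rewrite lerD2r.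
  exact: l1D.
have := H a (s + 1) a1; have := H b (s - 1) b1.
have := H c s c1; have := H d s d1.
move: (l1 _) (l1 _) (l1 _) (l1 _) (l1 _) L => l0 l2 l3 l4 l5 L.
rewrite !ler_pdivlMr // -[N.+1%:R]natr1 => H1 H2 H3 H4.
by have := ler_wpM2r (ltW tau2) L; rewrite !mulrDl -!mulrA; lra.
Qed.

(** Applying N steps halves every element of mass zero supported on X, by
   [l1_mull_mass0], and the rate 1 - 1 / (2 N) satisfies
   (1 - 1 / (2 N)) ^+ N >= 1/2 by the Bernoulli inequality; the factor 2 pays
   for an incomplete last block. *)
Lemma l1_block_decay (X : {group gT}) (q f : A) (N k : nat) :
    (0 < N)%N -> supp X q -> l1 q <= 1 -> supp X f -> mass f = 0 ->
    {in X, forall g, l1 (q ^+ N * (1 - dirac R g)) <= 2^-1} ->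
  l1 (q ^+ k * f) <= 2 * l1 f * (1 - (2 * N%:R)^-1) ^+ k.
Proof.
move=> N0 Xq q1 Xf f0 qN; set th := 1 - _.
have th0 : 0 <= th.
  by rewrite subr_ge0 invf_le1 -?natrM ?ler1n ?ltr0n muln_gt0.
have th1 : th <= 1 by rewrite gerBl invr_ge0 mulr_ge0.
have thN : 2^-1 <= th ^+ N.
  have bern k' : 1 - k'%:R * (2 * N%:R)^-1 <= th ^+ k'.
    elim: k' => [|k' IH]; first by rewrite mul0r subr0 expr0.
    rewrite exprS; apply: le_trans (ler_wpM2l th0 IH).
    have : 0 <= (2 * N%:R)^-1 :> R by rewrite invr_ge0 mulr_ge0.
    rewrite /th -[k'.+1%:R]natr1; have := ler0n R k'.
    move: (2 * N%:R)^-1 k'%:R => u v v0 u0.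
    by have := mulr_ge0 v0 (mulr_ge0 u0 u0); nra.
  by apply: le_trans (bern N); rewrite invfM mulrCA mulfV ?mulr1 ?pnatr_eq0 -?lt0n //; lra.
(* The blocks of N steps preserve the support and the mass. *)
have blk j : supp X (q ^+ (j * N) * f) /\ mass (q ^+ (j * N) * f) = 0.
  split; first by apply: suppM => //; apply: suppX.
  by rewrite massM f0 mulr0.
have dec j : l1 (q ^+ (j * N) * f) <= th ^+ (j * N) * l1 f.
  elim: j => [|j IH]; first by rewrite mul0n !expr0 !mul1r.
  have [Xj fj] := blk j; rewrite mulSn !exprD -!mulrA.
  apply: le_trans (l1_mull_mass0 Xj fj qN) _.
  by rewrite ler_pM ?invr_ge0 ?l1_ge0.
rewrite (divn_eq k N) addnC !exprD -mulrA.
apply: le_trans (l1M1 _ (l1X _ q1)) _; apply: le_trans (dec _) _.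
rewrite [leRHS](_ : _ =
  (2 * th ^+ (k %% N)) * (th ^+ (k %/ N * N) * l1 f)); last by ring.
rewrite ler_peMl ?mulr_ge0 ?exprn_ge0 ?l1_ge0 //.
have: th ^+ N <= th ^+ (k %% N).
  by apply: ler_wiXn2l => //; rewrite ltnW // ltn_mod.
lra.
Qed.

(** The change of z under translation is subadditive in the translation. *)
Lemma l1_1BdiracM (z : A) (g h : gT) :
  l1 (z * (1 - dirac R (g * h)%g)) <=
    l1 (z * (1 - dirac R g)) + l1 (z * (1 - dirac R h)).
Proof.
have -> : z * (1 - dirac R (g * h)%g) =
    z * (1 - dirac R h) + z * (1 - dirac R g) * dirac R h.
  by rewrite -diracM !mulrBr !mulr1 mulrBl -mulrA addrA subrK.
by rewrite addrC; apply: le_trans (l1D _ _) _; rewrite lerD2r l1M1r ?l1_dirac.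
Qed.

Lemma l1_1BdiracX (z : A) (g : gT) k :
  l1 (z * (1 - dirac R (g ^+ k)%g)) <= k%:R * l1 (z * (1 - dirac R g)).
Proof.
elim: k => [|k IH]; first by rewrite expg0 dirac1 subrr mulr0 l1_0 mul0r.
rewrite expgS; apply: le_trans (l1_1BdiracM _ _ _) _.
by rewrite -natr1 mulrDl mul1r addrC lerD2r.
Qed.

End Estimates.

(** * The walk on Z/pZ with steps 1, -1, a, -a *)
Section CyclicWalk.
Variables (R : realFieldType) (gT : finGroupType) (p : nat).
Variable x : 'F_p -> gT.
Hypothesis xD : forall y z, x (y + z) = (x y * x z)%g.
Local Notation A := (galg R gT).
Local Notation e y := (dirac R (x y) : A).

Definition four_step (a : 'F_p) : A :=
  4^-1 *: (e 1 + e (- 1) + e a + e (- a)).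

Lemma hom0 : x 0 = 1%g.
Proof. by apply: (mulgI (x 0)); rewrite -xD addr0 mulg1. Qed.

Lemma homMn y k : x (y *+ k) = (x y ^+ k)%g.
Proof. by elim: k => [|k IH]; rewrite ?hom0 // mulrS xD IH expgS. Qed.

Lemma dirac_hom_comm y z : GRing.comm (e y) (e z).
Proof. by rewrite /GRing.comm !diracM -!xD addrC. Qed.

Lemma l1_four_step a : l1 (four_step a) <= 1.
Proof.
rewrite l1Z ger0_norm ?invr_ge0 //.
suff: l1 (e 1 + e (- 1) + e a + e (- a)) <= 4 by lra.
have := l1D (e 1 + e (- 1) + e a) (e (- a)).
have := l1D (e 1 + e (- 1)) (e a); have := l1D (e 1) (e (- 1)).
rewrite !l1_dirac; lra.
Qed.

(** The translation by 2 w moves e (- w) to e w, so it is compared with the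
   difference of the two letters w and - w. For words of length 2 tau ^ 2,
   the parameter tau is the best one in [l1_walk_derivative]. *)
Lemma l1_four_step_diff (q u v : A) (w : 'F_p) (tau : nat) :
    (0 < tau)%N -> l1 q <= 1 -> l1 u <= 1 -> l1 v <= 1 ->
    (forall y, GRing.comm (e y) u) -> (forall y, GRing.comm (e y) v) ->
    q = 4^-1 *: (e w + e (- w) + u + v) ->
  l1 (q ^+ (2 * tau ^ 2) * (1 - dirac R (x (w *+ 2)))) <= 2 / tau%:R.
Proof.
move=> t0 q1 u1 v1 cu cv def_q; set N := (2 * tau ^ 2)%N.
have tR : 0 < tau%:R :> R by rewrite ltr0n.
have N0 : (0 < N)%N by rewrite muln_gt0 expn_gt0 t0.
have D y : l1 (e y) <= 1 by rewrite l1_dirac.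
have := @l1_walk_derivative R gT (e w) (e (- w)) u v tau%:R 0 N tR
  (dirac_hom_comm _ _) (cu _) (cv _) (cu _) (cv _) (D _) (D _) u1 v1.
rewrite /= -def_q scale0r addr0 l1Z -scalerAr l1Z.
rewrite expr0n /= add0r !ger0_norm ?invr_ge0 ?ler0n //.
have -> : N%:R = 2 * tau%:R ^+ 2 :> R by rewrite natrM natrX.
set d := l1 (q ^+ N.-1 * _) => le_d.
have le_d2 : d <= 2 / tau%:R.
  move: le_d; rewrite ler_pdivlMr ?mulr_gt0 // ler_pdivlMr // => le_d.
  have t2 : 0 < tau%:R ^+ 2 :> R by rewrite exprn_gt0.
  rewrite -(ler_pM2l t2); nra.
apply: le_trans le_d2; rewrite -(prednK N0).
have -> : 1 - dirac R (x (w *+ 2)) = - (e w - e (- w)) * e w.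
  by rewrite mulNr mulrBl !diracM -!xD addNr hom0 dirac1 opprB mulr2n.
rewrite mulrA; apply: le_trans (l1M1r _ (D _)) _.
by rewrite mulrN l1N exprS -mulrA; apply: l1M1.
Qed.

(** Halving y modulo p and dividing by a write y as 2 r + 2 a s, with
   r < a <= 2 m and s < 4 m. The length is 2 (24 m) ^ 2, for which each unit
   of r or s costs 2 / (24 m) by [l1_four_step_diff]; at most 6 m units add up
   to at most 1/2. *)
Lemma four_step_half (m a : nat) :
    prime p -> odd p -> (0 < m)%N -> (m ^ 2 <= p < m.+1 ^ 2)%N ->
    (m <= a <= m.+1)%N ->
  forall y, l1 (four_step a%:R ^+ (1152 * m ^ 2) * (1 - dirac R (x y))) <= 2^-1.
Proof.
move=> p_pr p_odd m0 /andP[mp pm] /andP[ma am] y.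
have p2 : 2%:R != 0 :> 'F_p.
  rewrite -(dvdn_pcharf (pchar_Fp p_pr)) gtnNdvd //.
  by have := prime_gt1 p_pr; move: p_odd; case: (p) => [|[|[|]]].
set z : nat := (y / 2%:R : 'F_p).
have zp : (z < p)%N.
  by have := ltn_ord (y / 2%:R); rewrite [X in (_ < X)%N](Fp_cast p_pr).
have yE : y = 1 *+ 2 *+ (z %% a)%N + a%:R *+ 2 *+ (z %/ a)%N.
  rewrite -!mulrnA (mulnC 2%N (z %% a)%N) (mulnC 2%N (z %/ a)%N) !mulrnA.
  rewrite -mulrnDl -[a%:R *+ _]mulrnA [(a * _)%N]mulnC -mulrnDr addnC.
  by rewrite -divn_eq natr_Zp -[RHS]mulr_natr divfK.
have t0 : (0 < 24 * m)%N by rewrite muln_gt0.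
have N_eq : (1152 * m ^ 2 = 2 * (24 * m) ^ 2)%N by rewrite expnMn mulnA.
have D w : l1 (e w) <= 1 by rewrite l1_dirac.
set q := four_step _; have q1 : l1 q <= 1 by apply: l1_four_step.
have B1 := @l1_four_step_diff q (e a%:R) (e (- a%:R)) 1 _ t0 q1 (D _) (D _)
  (fun _ => dirac_hom_comm _ _) (fun _ => dirac_hom_comm _ _) erefl.
have qE : q = 4^-1 *: (e a%:R + e (- a%:R) + e 1 + e (- 1)).
  by rewrite -[_ + e 1 + _]addrA addrC addrA.
have B2 := @l1_four_step_diff q (e 1) (e (- 1)) a%:R _ t0 q1 (D _) (D _)
  (fun _ => dirac_hom_comm _ _) (fun _ => dirac_hom_comm _ _) qE.
rewrite -N_eq in B1 B2; rewrite {1}yE xD homMn (homMn (a%:R *+ 2)).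
apply: le_trans (l1_1BdiracM _ _ _) _.
have B3 := le_trans (l1_1BdiracX _ _ _) (ler_wpM2l (ler0n R (z %% a)%N) B1).
have B4 := le_trans (l1_1BdiracX _ _ _) (ler_wpM2l (ler0n R (z %/ a)%N) B2).
apply: le_trans (lerD B3 B4) _; rewrite -mulrDl -natrD mulrCA.
have le6 : (z %% a + z %/ a <= 6 * m)%N.
  have a0 : (0 < a)%N by apply: leq_trans ma.
  have r_lt : (z %% a < a)%N by rewrite ltn_mod.
  have q_lt : (z %/ a < 4 * m)%N.
    rewrite ltn_divLR //; apply: leq_trans zp (leq_trans (ltnW pm) _).
    have le_m : (m.+1 ^ 2 <= (2 * m) ^ 2)%N.
      by rewrite leq_exp2r // mul2n -addnn -addn1 leq_add2l.
    apply: leq_trans le_m _.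
    by rewrite expnMn -mulnA leq_mul2l /= leq_mul2l ma orbT.
  by move: r_lt q_lt am m0; move: (z %% a)%N (z %/ a)%N => r s; clear; lia.
have mR : 0 < m%:R :> R by rewrite ltr0n.
have : (z %% a + z %/ a)%N%:R / m%:R <= 6 :> R.
  by rewrite ler_pdivrMr // -natrM ler_nat.
rewrite natrM invfM; move: (_%:R) (m%:R^-1) => u v; nra.
Qed.

End CyclicWalk.

(** * The unitriangular group and its chain of corner subgroups *)
Lemma mulmx_commutatorB1 (F : nzRingType) n (a b : 'M[F]_n) :
  (a - 1%:M) *m (b - 1%:M) - (b - 1%:M) *m (a - 1%:M) = a *m b - b *m a.
Proof.
rewrite !mulmxBl !mulmxBr !mul1mx !mulmx1 !opprB.
rewrite (AC (2*2*(2*2)) ((1*8)*(5*2)*(3*6)*(7*4))) /=.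
by rewrite !subrr !addr0.
Qed.

Definition unitri (F : nzRingType) d (A : 'M[F]_d.+1) :=
  forall i j : 'I_d.+1, (j <= i)%N -> A i j = (i == j)%:R.

Lemma delta_mulmxE (F : nzRingType) m n q (i : 'I_m) (j : 'I_n) (A : 'M[F]_(n, q)) a b :
  (delta_mx i j *m A) a b = (a == i)%:R * A j b.
Proof.
rewrite mxE (bigD1 j) //= mxE eqxx andbT big1 ?addr0 // => k /negPf ne.
by rewrite mxE ne andbF mul0r.
Qed.

Lemma mulmx_deltaE (F : nzRingType) m n q (i : 'I_n) (j : 'I_q) (A : 'M[F]_(m, n)) a b :
  (A *m delta_mx i j) a b = A a i * (b == j)%:R.
Proof.
rewrite mxE (bigD1 i) //= mxE eqxx big1 ?addr0 // => k /negPf ne.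
by rewrite mxE ne mulr0.
Qed.

(** The group is given by a faithful matrix representation whose image is
   the set of unitriangular matrices; this keeps the argument away from the
   concrete representation of matrix groups. *)
Section UnitriangularGroup.
Variables (F : finFieldType) (gT : finGroupType) (G : {group gT}) (d : nat).
Variable mat : gT -> 'M[F]_d.+1.
Hypothesis mat1 : mat 1%g = 1%:M.
Hypothesis matM : forall g h, mat (g * h)%g = mat g *m mat h.
Hypothesis mat_inj : injective mat.
Hypothesis unitri_mat : forall g, g \in G <-> unitri (mat g).
Hypothesis mat_surj : forall A, unitri A -> exists g, mat g = A.
Local Notation M := 'M[F]_d.+1.
Implicit Types (g h : gT) (k : nat) (A B Z : M) (c : 'I_d).

Definition src c : 'I_d.+1 := widen_ord (leqnSn _) c.
Definition tgt c : 'I_d.+1 := lift ord0 c.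

Lemma tgtE c : tgt c = c.+1 :> nat. Proof. by []. Qed.

Definition upper A := forall i j : 'I_d.+1, (j < i)%N -> A i j = 0.
Definition strict A := forall i j : 'I_d.+1, (j <= i)%N -> A i j = 0.
(** These are the matrices above the superdiagonal with nonzero entries in
   the first k rows only. *)
Definition top_corner k Z :=
  forall i j : 'I_d.+1, (k <= i)%N || (j <= i.+1)%N -> Z i j = 0.

Lemma UT_upper g : g \in G -> upper (mat g).
Proof.
move=> /unitri_mat gG i j lt_ji.
have /negPf ne_ij : i != j by apply: contraTneq lt_ji => ->; rewrite ltnn.
by rewrite (gG _ _ (ltnW lt_ji)) ne_ij.
Qed.

Lemma UT_strict g : g \in G -> strict (mat g - 1%:M).
Proof. by move=> /unitri_mat gG i j le_ji; rewrite !mxE gG // subrr. Qed.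

Lemma top_corner_mull k A Z : upper A -> top_corner k Z -> top_corner k (A *m Z).
Proof.
move=> uA tZ i j ij; rewrite mxE big1 // => l _.
have [lt_li|le_il] := ltnP l i; first by rewrite uA ?mul0r.
by rewrite tZ ?mulr0 //; lia.
Qed.

Lemma top_corner_mulr k A Z : upper A -> top_corner k Z -> top_corner k (Z *m A).
Proof.
move=> uA tZ i j ij; rewrite mxE big1 // => l _.
have [lt_lj|le_jl] := ltnP j l; first by rewrite uA ?mulr0.
by rewrite tZ ?mul0r //; lia.
Qed.

Lemma top_cornerD k A B :
  top_corner k A -> top_corner k B -> top_corner k (A + B).
Proof. by move=> tA tB i j ij; rewrite mxE tA ?tB ?addr0. Qed.

Lemma top_cornerN k A : top_corner k A -> top_corner k (- A).
Proof. by move=> tA i j ij; rewrite mxE tA ?oppr0. Qed.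

Lemma strictM A B : strict A -> strict B -> top_corner d (A *m B).
Proof.
move=> sA sB i j ij; rewrite mxE big1 // => l _.
have [le_li|lt_il] := leqP l i; first by rewrite sA ?mul0r.
by rewrite sB ?mulr0 //; have := ltn_ord l; lia.
Qed.

(** For k = d this is the commutator subgroup; k = 0 gives the trivial
   group. *)
Definition corner_set k : {set gT} :=
  [set g | [forall i : 'I_d.+1, forall j : 'I_d.+1,
    (k <= i)%N || (j <= i.+1)%N ==> ((mat g - 1%:M) i j == 0)]].

Lemma cornerP k g : reflect (top_corner k (mat g - 1%:M)) (g \in corner_set k).
Proof.
rewrite inE; apply: (iffP forallP) => [gP i j ij | gP i].
  by have /forallP/(_ j)/implyP/(_ ij)/eqP := gP i.
by apply/forallP=> j; apply/implyP=> ij; apply/eqP/gP.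
Qed.

Lemma corner_sub k : corner_set k \subset G.
Proof.
apply/subsetP=> g /cornerP gP; apply/unitri_mat=> i j le_ji.
have := gP i j; rewrite (leqW le_ji) orbT !mxE => /(_ isT) /eqP.
by rewrite subr_eq0 => /eqP.
Qed.

Lemma corner_group_set k : group_set (corner_set k).
Proof.
apply/group_setP; split=> [|g h gK /cornerP hP].
  by apply/cornerP=> i j _; rewrite mat1 subrr mxE.
have gG := UT_upper (subsetP (corner_sub k) g gK); move/cornerP: gK => gP.
apply/cornerP; rewrite matM.
have -> : mat g *m mat h - 1%:M =
    mat g *m (mat h - 1%:M) + (mat g - 1%:M).
  by rewrite mulmxBr mulmx1 addrA subrK.
by apply: top_cornerD => //; apply: top_corner_mull.
Qed.

Canonical corner k : {group gT} := Group (corner_group_set k).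

Lemma corner_conj k g h : h \in G -> g \in corner k -> (g ^ h)%g \in corner k.
Proof.
move=> hG /cornerP gP; apply/cornerP.
have hVG := groupVr hG.
have -> : mat (g ^ h)%g - 1%:M =
    mat h^-1%g *m ((mat g - 1%:M) *m mat h).
  rewrite mulmxBl mul1mx mulmxBr -!matM mulVg conjgE mulgA.
  by rewrite mat1.
by apply: top_corner_mull (UT_upper hVG) (top_corner_mulr (UT_upper hG) gP).
Qed.

Lemma corner_normal k h : h \in G -> (corner k :^ h)%g = corner k.
Proof.
move=> hG; apply/setP=> g; rewrite mem_conjg; apply/idP/idP => [gK|gK].
  have := corner_conj hG gK; rewrite conjgKV; exact.
exact: corner_conj (groupVr hG) gK.
Qed.

Lemma corner0 g : g \in corner 0 -> g = 1%g.
Proof.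
move=> /cornerP gP; have g1 : mat g - 1%:M = 0.
  by apply/matrixP=> i j; rewrite gP ?mxE.
by apply: mat_inj; rewrite mat1; apply: subr0_eq.
Qed.

Lemma corner_commg g h : g \in G -> h \in G -> [~ g, h]%g \in corner d.
Proof.
move=> gG hG; apply/cornerP.
have hgV := groupM (groupVr gG) (groupVr hG).
have sg := UT_strict gG; have sh := UT_strict hG.
have -> : mat [~ g, h]%g - 1%:M = mat (g^-1 * h^-1)%g *m
   (mat g *m mat h - mat h *m mat g).
  rewrite mulmxBr -!matM -(mat1).
  congr (mat _ - mat _); first by rewrite commgEl conjgE !mulgA.
  by rewrite -invMg mulVg.
rewrite -mulmx_commutatorB1; apply: top_corner_mull (UT_upper hgV) _.
by apply: top_cornerD; [|apply: top_cornerN]; apply: strictM.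
Qed.

Lemma src_neq_tgt c : (src c == tgt c) = false.
Proof. by rewrite -val_eqE /= /bump /=; apply/eqP; lia. Qed.

Lemma superdiagM g h c : g \in G -> h \in G ->
  mat (g * h)%g (src c) (tgt c) =
    mat g (src c) (tgt c) + mat h (src c) (tgt c).
Proof.
move=> gG hG; rewrite matM.
have := strictM (UT_strict gG) (UT_strict hG) => T.
have -> : mat g *m mat h = (mat g - 1%:M) *m (mat h - 1%:M) + mat g + mat h - 1%:M.
  rewrite mulmxBl !mulmxBr !mul1mx !mulmx1 opprB.
  by rewrite (AC (2*2*1*1*1) ((1*(2*5)*(4*6)*(3*7)))) /= !addNr subrr !addr0.
rewrite 3!mxE T ?leqnn ?orbT // add0r !mxE src_neq_tgt subr0.
by [].
Qed.

Lemma corner_superdiag g : g \in G ->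
  (forall c, mat g (src c) (tgt c) = 0) -> g \in corner d.
Proof.
move=> gG g0; apply/cornerP=> i j.
have [le_ji _|lt_ij /=] := leqP j i; first exact: UT_strict.
have id : (i < d)%N by have := ltn_ord j; lia.
rewrite leqNgt id /= => le_ji.
have -> : i = src (Ordinal id) by apply: val_inj.
have -> : j = tgt (Ordinal id) by apply: val_inj; rewrite /= /bump /=; lia.
rewrite !mxE g0 -val_eqE /= /bump /=; case: eqP; last by rewrite subrr.
lia.
Qed.

Lemma mat_conj g h A : mat h *m A = mat g *m mat h -> mat (g ^ h)%g = A.
Proof.
by move=> hA; rewrite conjgE !matM -hA mulmxA -matM mulVg mat1 mul1mx.
Qed.

Variable elt : 'I_d -> F -> gT.
Hypothesis mat_elt :
  forall c y, mat (elt c y) = 1%:M + y *: delta_mx (src c) (tgt c).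

Lemma elt_UT c y : elt c y \in G.
Proof.
apply/unitri_mat=> i j le_ji; rewrite mat_elt !mxE.
have [i_src|_] := eqVneq i (src c); last by rewrite mulr0 addr0.
have [j_tgt|_] := eqVneq j (tgt c); last by rewrite mulr0 addr0.
by move: le_ji; rewrite i_src j_tgt tgtE ltnn.
Qed.

Lemma eltD c y z : elt c (y + z) = (elt c y * elt c z)%g.
Proof.
apply: mat_inj; rewrite matM !mat_elt mulmxDl mul1mx mulmxDr mulmx1.
rewrite -scalemxAr -scalemxAl mul_delta_mx_0 ?scaler0 ?addr0.
  by rewrite scalerDl [y *: _ + _]addrC addrA.
by rewrite eq_sym src_neq_tgt.
Qed.

Lemma elt_superdiag c c' y :
  mat (elt c y) (src c') (tgt c') = y *+ (c' == c).
Proof.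
rewrite mat_elt !mxE src_neq_tgt add0r -![_ == _ :> 'I_d.+1]val_eqE /= /bump /=.
rewrite !add1n eqSS andbb val_eqE.
by case: eqP; rewrite ?mulr1 ?mulr0.
Qed.

(** Left multiplication by h - 1 only matters through row src c, since the
   rows above are absorbed by [corner c] and the rows below vanish.
   Conjugating by 1 + y^-1 E (h - 1), where E has its only nonzero entry at
   (tgt c, src c), produces exactly this row. *)
Lemma class_corner_step c (y : F) h : y != 0 -> h \in corner c.+1 ->
  exists g w, [/\ g \in G, w \in corner c & (elt c y * h = elt c y ^ g * w)%g].
Proof.
move=> y0 hK; have hG := subsetP (corner_sub _) _ hK.
have [Z mat_h hZ] : exists2 Z, mat h = 1%:M + Z & top_corner c.+1 Z.
  by exists (mat h - 1%:M); [rewrite addrC subrK | apply/cornerP].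
set E := delta_mx (src c) (tgt c) : M.
set P := y^-1 *: (delta_mx (tgt c) (src c) *m Z).
have uniP : unitri (1%:M + P).
  move=> i j le_ji; rewrite mxE [X in X + _]mxE [X in _ + X]mxE delta_mulmxE.
  have [i_tgt|_] := eqVneq i (tgt c); last by rewrite mul0r mulr0 addr0.
  by rewrite hZ ?mulr0 ?addr0 //; move: le_ji; rewrite i_tgt => ->; rewrite orbT.
have [g mat_g] := mat_surj uniP.
have gG : g \in G by apply/unitri_mat; rewrite mat_g.
have Zss : Z (src c) (src c) = 0 by rewrite hZ // leqnSn orbT.
(* The product P E vanishes because (h - 1) has a zero at (src c, src c). *)
have mat_xg : mat (elt c y ^ g)%g =
    1%:M + y *: E + delta_mx (src c) (src c) *m Z.
  apply: mat_conj; rewrite mat_elt mat_g -/E.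
  have PE j : P *m delta_mx (src c) j = 0.
    apply/matrixP=> a b; rewrite mulmx_deltaE [P _ _]mxE delta_mulmxE Zss.
    by rewrite [RHS]mxE !mulr0 mul0r.
  rewrite !mulmxDl !mulmxDr !mul1mx !mulmx1. rewrite mulmxA PE mul0mx addr0.
  rewrite -scalemxAr PE scaler0 addr0.
  rewrite /P -scalemxAl -scalemxAr scalerA mulfV // scale1r mulmxA mul_delta_mx.
  by rewrite [LHS](ACl ((1*4)*(2*3))).
exists g, ((elt c y ^ g)^-1 * (elt c y * h))%g; split=> //; last by rewrite mulKVg.
apply/cornerP; set xg := (elt c y ^ g)%g.
have xgVG : (xg^-1)%g \in G by rewrite groupV groupJ // elt_UT.
have -> : mat (xg^-1 * (elt c y * h))%g - 1%:M =
    mat xg^-1%g *m (mat (elt c y * h)%g - mat xg).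
  by rewrite mulmxBr -!matM mulVg mat1.
apply: top_corner_mull (UT_upper xgVG) _.
have -> : mat (elt c y * h)%g - mat xg =
    Z - delta_mx (src c) (src c) *m Z + y *: (E *m Z).
  rewrite mat_xg matM mat_elt mat_h -/E mulmxDr mulmx1 mulmxDl mul1mx.
  by rewrite -scalemxAl opprD (AC (1*2*2) ((4*1)*(2*5)*3)) /= addNr add0r.
move=> i j ij.
have Etgt : (E *m Z) i j = 0.
  by rewrite delta_mulmxE hZ ?mulr0 // tgtE leqnn.
rewrite mxE [X in _ + X]mxE Etgt mulr0 addr0 mxE [X in _ + X]mxE delta_mulmxE.
case: eqP => [->|ne_i]; first by rewrite mul1r subrr.
rewrite mul0r subr0 hZ //; move: ij => /orP[le_ci|->]; last by rewrite orbT.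
apply/orP; left; rewrite ltn_neqAle le_ci andbT; apply/eqP => E1.
by apply: ne_i; apply: val_inj.
Qed.

(** The conjugate by g is 1 + y u v, where u is a column of the inverse of g
   and v a row of g: u is 1 at src c and 0 below, v is 1 at tgt c and 0 to
   the left, the other entries being free. The free entries of u and v have
   disjoint index sets, hence fit into one function f that vanishes at src c
   and tgt c. *)
Lemma card_class_elt c (y : F) : y != 0 -> #|(elt c y ^: G)%g| = (#|F| ^ d.-1)%N.
Proof.
move=> y0.
pose U (f : {ffun 'I_d.+1 -> F}) : 'cV[F]_d.+1 :=
  \col_i (if i == src c then 1 else if (i < c)%N then f i else 0).
pose V (f : {ffun 'I_d.+1 -> F}) : 'rV[F]_d.+1 :=
  \row_j (if j == tgt c then 1 else if (tgt c < j)%N then f j else 0).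
pose D := [set i : 'I_d.+1 | i != src c & i != tgt c].
pose X f := 1%:M + y *: (U f *m V f).
have UVE f i j : (U f *m V f) i j = U f i 0 * V f 0 j.
  by rewrite mxE big_ord1.
have cardD : #|D| = d.-1.
  have -> : D = ~: [set src c; tgt c].
    by apply/setP=> i; rewrite !inE negb_or.
  by rewrite cardsCs setCK card_ord cards2 src_neq_tgt subSS subn1.
rewrite -cardD -(card_pffun_on 0) -(card_imset _ mat_inj).
rewrite -[RHS](card_in_imset (f := X)) /=; last first.
  move=> f1 f2 /pffun_onP[D1 _] /pffun_onP[D2 _] /matrixP E12.
  have UV i j : U f1 i 0 * V f1 0 j = U f2 i 0 * V f2 0 j.
    have := E12 i j; rewrite mxE [RHS]mxE => /addrI.
    by rewrite mxE [RHS]mxE !UVE => /(mulfI y0).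
  apply/ffunP=> i; have [iD|iD] := boolP (i \in D).
    move: iD; rewrite inE => /andP[i_src i_tgt].
    have [lt_ic|le_ci] := ltnP i c.
      have := UV i (tgt c); rewrite !mxE eqxx (negPf i_src) lt_ic !mulr1.
      by [].
    have lt_i : (tgt c < i)%N.
      move: i_src i_tgt; rewrite -!val_eqE /= /bump /=; lia.
    have := UV (src c) i; rewrite !mxE eqxx (negPf i_tgt) lt_i !mul1r.
    by [].
  have z f : 0.-support f \subset D -> f i = 0.
    by move=> Df; apply/eqP; apply: contraR iD => fi; apply: (subsetP Df).
  by rewrite !z.
apply: eq_card => A; apply/imsetP/imsetP=> [[_ /imsetP[g gG ->] ->]|[f fD ->]].
  pose f := [ffun i : 'I_d.+1 => if (i < c)%N then mat g^-1%g i (src c)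
     else if (tgt c < i)%N then mat g (tgt c) i else 0] : {ffun 'I_d.+1 -> F}.
  exists f.
    apply/pffun_onP; split=> //; apply/subsetP=> i; rewrite !inE ffunE.
    apply: contraR; rewrite -negb_or negbK => /orP[]/eqP->.
      by rewrite ltnn ltnNge tgtE leqnSn.
    by rewrite tgtE ltnNge leqnSn ltnn.
  rewrite conjgE !matM mat_elt mulmxDl mul1mx mulmxDr -matM mulVg mat1.
  congr (_ + _); rewrite -scalemxAl -scalemxAr; congr (_ *: _).
  have gVG : g^-1%g \in G by rewrite groupV.
  apply/matrixP=> i j; rewrite UVE mxE.
  under eq_bigr do rewrite delta_mulmxE.
  rewrite (bigD1 (src c)) //= eqxx mul1r big1 ?addr0; last first.
    by move=> k /negPf ->; rewrite mul0r mulr0.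
  rewrite !mxE !ffunE; congr (_ * _).
    case: eqP => [->|/eqP ne]; first by have /unitri_mat -> := gVG; rewrite ?eqxx.
    case: ltnP => // le_ci; have /unitri_mat -> // := gVG; first by rewrite (negPf ne).
  case: eqP => [->|/eqP ne]; first by have /unitri_mat -> := gG; rewrite ?eqxx.
  have [lt_j|le_j] := ltnP (tgt c) j.
    by rewrite ltnNge (ltnW (ltn_trans (ltnSn c) lt_j)).
  by have /unitri_mat -> // := gG; rewrite eq_sym (negPf ne).
(* Conversely, conjugation by b turns the row of index tgt c into V f, and
   then conjugation by a^-1 turns the column of index src c into U f. *)
pose es : 'cV[F]_d.+1 := delta_mx (src c) 0.
pose et : 'rV[F]_d.+1 := delta_mx 0 (tgt c).
pose es' : 'rV[F]_d.+1 := delta_mx 0 (src c).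
pose et' : 'cV[F]_d.+1 := delta_mx (tgt c) 0.
have one11 : delta_mx 0 0 = 1%:M :> 'M[F]_1.
  by apply/matrixP=> i j; rewrite !mxE !ord1.
have mat_surj_in B : unitri B -> exists2 g, g \in G & mat g = B.
  by move=> uB; have [g gB] := mat_surj uB; exists g => //; apply/unitri_mat; rewrite gB.
have [b bG mat_b] : exists2 b, b \in G & mat b = 1%:M + et' *m (V f - et).
  apply: mat_surj_in => i j le_ji; rewrite mxE [X in X + _]mxE delta_mulmxE.
  have [i_tgt|_] := eqVneq i (tgt c); last by rewrite mul0r addr0.
  rewrite !mxE eqxx /=; move: le_ji; rewrite i_tgt => le_jt.
  have [_|ne] := eqVneq j (tgt c); first by rewrite subrr mulr0 addr0.
  by rewrite ltnNge le_jt subrr mulr0 addr0.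
have [a aG mat_a] : exists2 a, a \in G & mat a = 1%:M + (U f - es) *m es'.
  apply: mat_surj_in => i j le_ji; rewrite mxE [X in X + _]mxE mulmx_deltaE.
  have [j_src|_] := eqVneq j (src c); last by rewrite mulr0 addr0.
  rewrite !mxE eqxx andbT; move: le_ji; rewrite j_src => le_si.
  have [_|ne] := eqVneq i (src c); first by rewrite subrr mul0r addr0.
  by rewrite ltnNge le_si subrr mul0r addr0.
have V0 (j : 'I_d.+1) : (j <= c)%N -> V f 0 j = 0.
  move=> le_jc; rewrite mxE ltnNge (leqW le_jc) /=.
  by case: eqP le_jc => // ->; rewrite tgtE ltnn.
have U0 (i : 'I_d.+1) : (c < i)%N -> (U f - es) i 0 = 0.
  move=> lt_ci; rewrite !mxE eqxx andbT (ltnNge i) (ltnW lt_ci) /=.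
  by case: eqP lt_ci => [->|_ _]; rewrite ?ltnn ?subrr.
have bes : mat b *m es = es.
  rewrite mat_b mulmxDl mul1mx -mulmxA [X in et' *m X](_ : _ = 0).
    by rewrite mulmx0 addr0.
  apply/matrixP=> i j; rewrite mulmx_deltaE [(V f - et) _ _]mxE ord1 V0 //.
  by rewrite !mxE src_neq_tgt andbF subrr mul0r.
have etb : et *m mat b = V f.
  rewrite mat_b mulmxDr mulmx1 mulmxA mul_delta_mx one11 mul1mx.
  by rewrite addrC subrK.
have aes : mat a *m es = U f.
  rewrite mat_a mulmxDl mul1mx -mulmxA mul_delta_mx one11 mulmx1.
  by rewrite addrC subrK.
have Va : V f *m mat a = V f.
  rewrite mat_a mulmxDr mulmx1 mulmxA [V f *m _](_ : _ = 0) ?mul0mx ?addr0 //.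
  apply/matrixP=> i j; rewrite mxE [RHS]mxE big1 // => k _; rewrite !ord1.
  have [le_kc|lt_ck] := leqP k c; first by rewrite V0 ?mul0r.
  by rewrite U0 ?mulr0.
have defE : delta_mx (src c) (tgt c) = es *m et by rewrite mul_delta_mx.
have mat_xb : mat (elt c y ^ b)%g = 1%:M + y *: (es *m V f).
  apply: mat_conj; rewrite mat_elt defE mulmxDl mulmxDr mulmx1 mul1mx.
  by rewrite -scalemxAl -scalemxAr mulmxA bes -mulmxA etb.
exists (elt c y ^ (b * a^-1))%g; first by apply: memJ_class; rewrite groupM ?groupV.
rewrite conjgM; apply/esym/mat_conj; rewrite mat_xb.
have aX : mat a *m (1%:M + y *: (es *m V f)) = X f *m mat a.
  rewrite /X mulmxDl mulmxDr mulmx1 mul1mx -scalemxAl -scalemxAr.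
  by rewrite mulmxA aes -mulmxA Va.
have aVa : mat a^-1%g *m mat a = 1%:M by rewrite -matM mulVg.
have aaV : mat a *m mat a^-1%g = 1%:M by rewrite -matM mulgV.
rewrite -[LHS]mulmx1 -aaV mulmxA -[_ *m X f *m _]mulmxA -aX.
by rewrite [mat a^-1%g *m _]mulmxA aVa mul1mx aaV.
Qed.

(** * The walk driven by conjugacy classes of elementary matrices *)
Section ClassWalk.
Variables (R : realFieldType) (js : seq F) (N : nat).
Hypothesis js_neq0 : forall y, y \in js -> y != 0.
Hypothesis js_gt0 : (0 < size js)%N.
Hypothesis d_gt0 : (0 < d)%N.
Local Notation A := (galg R gT).

Definition class_law c y : A := unifm R (elt c y ^: G)%g.
Definition coord_law c : A :=
  (size js)%:R^-1 *: \sum_(y <- js) class_law c y.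
Definition line_law c : A :=
  (size js)%:R^-1 *: \sum_(y <- js) dirac R (elt c y).
Definition corner_law k : A := unifm R (corner k).
Definition step_law : A := d%:R^-1 *: \sum_c coord_law c.
Local Notation pi := (corner_law d).
Local Notation U := (unifm R G).

Definition central (f : A) :=
  supp G f /\ {in G, forall g, GRing.comm f (dirac R g)}.

Lemma central_comm f f' : central f -> supp G f' -> GRing.comm f f'.
Proof. by move=> [_ cf] sf'; apply: supp_comm sf' cf. Qed.

Lemma central_class c y : central (class_law c y).
Proof.
split; first by apply: supp_sub (@supp_unifm _ _ _); rewrite class_subG ?elt_UT.
move=> g gG; apply: unifm_comm; apply/normP.
exact: (subsetP (class_norm _ G)).
Qed.

Lemma central_coord c : central (coord_law c).
Proof.
split; first by apply: suppZ; apply: supp_sum => y _; case: (central_class c y).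
move=> g gG; apply/commr_sym; rewrite /GRing.comm -scalerAr -scalerAl.
congr (_ *: _); apply: commr_sum => y _; apply/commr_sym.
by case: (central_class c y) => _; apply.
Qed.

Lemma corner_norm k : (G \subset 'N(corner k))%g.
Proof. by apply/subsetP=> g gG; apply/normP; apply: corner_normal. Qed.

Lemma central_corner k : central (corner_law k).
Proof.
split; first by apply: supp_sub (@supp_unifm _ _ _); apply: corner_sub.
by move=> g gG; apply: unifm_comm; apply: corner_normal.
Qed.

Lemma l1_avg (I : Type) (r : seq I) (f : I -> A) :
  (0 < size r)%N -> (forall i, l1 (f i) <= 1) ->
  l1 ((size r)%:R^-1 *: \sum_(i <- r) f i) <= 1.
Proof.
move=> r0 f1; rewrite l1Z ger0_norm ?invr_ge0 ?ler0n //.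
rewrite ler_pdivrMl ?ltr0n // mulr1; apply: le_trans (l1_sum _ _ _) _.
by apply: le_trans (ler_sum _ (fun i _ => f1 i)) _; rewrite big_const_seq count_predT iter_addr_0.
Qed.

Lemma mass_avg (I : Type) (r : seq I) (f : I -> A) :
  (0 < size r)%N -> (forall i, mass (f i) = 1) ->
  mass ((size r)%:R^-1 *: \sum_(i <- r) f i) = 1.
Proof.
move=> r0 f1; rewrite massZ mass_sum; under eq_bigr do rewrite f1.
by rewrite big_const_seq count_predT iter_addr_0 mulVf // pnatr_eq0 -lt0n.
Qed.

Lemma l1_coord c : l1 (coord_law c) <= 1.
Proof.
by apply: l1_avg => // y; rewrite (l1_unifm _ (class_refl G (elt c y))).
Qed.

Lemma l1_line c : l1 (line_law c) <= 1.
Proof. by apply: l1_avg => // y; rewrite l1_dirac. Qed.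

Lemma step_lawE : step_law = (size (enum 'I_d))%:R^-1 *: \sum_(c <- enum 'I_d) coord_law c.
Proof. by rewrite size_enum_ord big_enum. Qed.

Lemma l1_step : l1 step_law <= 1.
Proof. by rewrite step_lawE; apply: l1_avg => [|c]; rewrite ?size_enum_ord ?l1_coord. Qed.

Lemma mass_step : mass step_law = 1.
Proof.
rewrite step_lawE; apply: mass_avg => [|c]; first by rewrite size_enum_ord.
by apply: mass_avg => // y; rewrite (mass_unifm _ (class_refl G (elt c y))).
Qed.

Lemma central_step : central step_law.
Proof.
split; first by apply: suppZ; apply: supp_sum => y _; case: (central_coord y).
move=> g gG; apply/commr_sym; rewrite /GRing.comm -scalerAr -scalerAl.
congr (_ *: _); apply: commr_sum => y _; apply/commr_sym.
by case: (central_coord y) => _; apply.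
Qed.

Lemma l1_corner k : l1 (corner_law k) = 1.
Proof. exact: l1_unifm (group1 _). Qed.

(** Each class law at position c, multiplied by the law of [corner c],
   absorbs the next corner group, by [class_corner_step]. *)
Lemma coord_corner (c : 'I_d) :
  coord_law c * corner_law c * corner_law c.+1 = coord_law c * corner_law c.
Proof.
apply: (supp_mull (@supp_unifm _ _ _) (mass_unifm _ (group1 _))) => h hK.
rewrite /coord_law -!scalerAl !mulr_suml; congr (_ *: _).
apply: eq_big_seq => y yj; apply: (@unifm_class_absorb R gT G (corner c) (corner c.+1)) => //.
- exact: corner_sub.
- exact: corner_sub.
- exact: corner_norm.
- exact: corner_norm.
move=> h' h'K; have [g [w [gG wK ->]]] := class_corner_step (js_neq0 yj) h'K.
by apply: mem_mulg => //; apply: memJ_class.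
Qed.

(** Since the factors commute with the corner laws, the corner group absorbed
   by a product of the first k factors grows by one step with each factor. *)
Lemma coord_prod_corner k : (k <= d)%N ->
  (\prod_(c <- take k (enum 'I_d)) coord_law c) * corner_law k =
    \prod_(c <- take k (enum 'I_d)) coord_law c.
Proof.
elim: k => [_|k IH lt_kd].
  have K0 : corner_set 0 = [set 1%g].
    apply/setP=> g; rewrite in_set1; apply/idP/eqP=> [/corner0|->] //.
  rewrite take0 big_nil mul1r; apply/ffunP=> g.
  by rewrite !ffunE /= K0 in_set1 cards1 divr1.
pose c := Ordinal lt_kd; have {}IH := IH (ltnW lt_kd).
rewrite (take_nth c) ?size_enum_ord // -cats1 big_cat big_seq1.
rewrite (_ : nth c _ k = c); last exact: (nth_ord_enum c c).
move: IH; move: (\prod_(i <- _) _) => P /= IH.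
have cc : corner_law k * coord_law c = coord_law c * corner_law k.
  by apply: central_comm; [apply: central_corner | case: (central_coord c)].
by rewrite -IH -!(mulrA P) cc (coord_corner c).
Qed.

Lemma coord_prod_pi : (\prod_(c <- enum 'I_d) coord_law c) * (1 - pi) = 0.
Proof.
have := coord_prod_corner (leqnn d).
rewrite take_oversize ?size_enum_ord // => E.
by rewrite mulrBr mulr1 E subrr.
Qed.

(** Modulo the commutator subgroup, a conjugacy class is a point. *)
Lemma coord_pi c : coord_law c * pi = line_law c * pi.
Proof.
rewrite -!scalerAl !mulr_suml; congr (_ *: _).
apply: eq_bigr => y _; have xC := class_refl G (elt c y).
apply: (supp_mulr (@supp_unifm _ _ _) (mass_unifm _ xC)) => _ /imsetP[g gG ->].
rewrite -[(elt c y ^ g)%g](mulKVg (elt c y)) -commgEl -diracM -mulrA.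
by rewrite unifm_mull // corner_commg // elt_UT.
Qed.

Lemma line_group_set c : group_set [set elt c y | y : F].
Proof.
apply/group_setP; split=> [|_ _ /imsetP[y _ ->] /imsetP[z _ ->]].
  apply/imsetP; exists 0 => //; apply: (mulgI (elt c 0)).
  by rewrite -eltD addr0 mulg1.
by rewrite -eltD imset_f.
Qed.
Definition line_group c := Group (line_group_set c).

Hypothesis N_gt0 : (0 < N)%N.
Hypothesis line_half : forall c y,
  l1 (line_law c ^+ N * (1 - dirac R (elt c y))) <= 2^-1.

(** The coordinate law contracts at rate 1 - 1 / (2 N), and the coordinate
   moves with probability 1/d. *)
Definition decay_rate : R := 1 - (2 * N%:R * d%:R)^-1.

Lemma decay_rate_ge0 : 0 <= decay_rate.
Proof. by rewrite subr_ge0 invf_le1 -!natrM ?ler1n ?ltr0n !muln_gt0 N_gt0. Qed.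

Lemma line_decay c y k :
  l1 (line_law c ^+ k * (1 - dirac R (elt c y))) <= 4 * (1 - (2 * N%:R)^-1) ^+ k.
Proof.
have inX z : elt c z \in line_group c by rewrite imset_f.
have q0 : 0 <= 1 - (2 * N%:R)^-1 :> R.
  by rewrite subr_ge0 invf_le1 -?natrM ?ler1n ?ltr0n muln_gt0.
apply: le_trans (@l1_block_decay R gT (line_group c) _ _ N k N_gt0 _ (l1_line c) _ _ _) _.
- by apply: suppZ; apply: supp_sum => z _; apply: supp_dirac.
- by apply: suppB; [apply: supp1 | apply: supp_dirac].
- by rewrite massD massN -dirac1 !mass_dirac subrr.
- by move=> _ /imsetP[z _ ->]; apply: line_half.
rewrite ler_wpM2r ?exprn_ge0 //.
have := l1D 1 (- dirac R (elt c y)); rewrite l1N l1_1 l1_dirac; lra.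
Qed.

Lemma coord_expr_pi c k : coord_law c ^+ k * pi = line_law c ^+ k * pi.
Proof.
have lG : supp G (line_law c).
  by apply: suppZ; apply: supp_sum => z _; apply: supp_dirac; apply: elt_UT.
elim: k => [|k IH]; first by rewrite !expr0.
rewrite exprSr -mulrA coord_pi -(central_comm (central_corner d) lG) mulrA IH.
by rewrite -mulrA (central_comm (central_corner d) lG) mulrA -exprSr.
Qed.

(** The coordinate c is moved with weight 1/d at each step; the other
   coordinates commute with it and have total norm at most 1 - 1/d. *)
Lemma step_decay c y t :
  l1 (step_law ^+ t * (pi * (1 - dirac R (elt c y)))) <= 4 * decay_rate ^+ t.
Proof.
have d0 : d%:R != 0 :> R by rewrite pnatr_eq0 -lt0n.
have N0 : N%:R != 0 :> R by rewrite pnatr_eq0 -lt0n.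
have dV : 0 <= d%:R^-1 :> R by rewrite invr_ge0.
have -> : decay_rate = (1 - (2 * N%:R)^-1) / d%:R + (1 - d%:R^-1).
  by rewrite /decay_rate; field; rewrite d0 N0.
have -> : step_law = d%:R^-1 *: coord_law c + d%:R^-1 *: \sum_(i | i != c) coord_law i.
  by rewrite /step_law (bigD1 c) //= scalerDr.
apply: l1_expD_comm.
- apply: commrZ; apply: commr_sum => i _; apply: central_comm; first exact: central_coord.
  by case: (central_coord i).
- rewrite l1Z ger0_norm // ler_pdivrMl ?ltr0n // mulrBr mulr1 mulfV //.
  apply: le_trans (l1_sum _ _ _) _.
  apply: le_trans (ler_sum _ (fun i _ => l1_coord i)) _.
  by rewrite sumr_const cardC1 card_ord -subn1 natrB.
move=> k; rewrite exprZn -scalerAl l1Z ger0_norm ?exprn_ge0 //.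
rewrite mulrA coord_expr_pi -mulrA.
have -> : pi * (1 - dirac R (elt c y)) = (1 - dirac R (elt c y)) * pi.
  apply: central_comm (central_corner d) _.
  by apply: suppB; [apply: supp1 | apply: supp_dirac; apply: elt_UT].
rewrite [leRHS](_ : _ = d%:R^-1 ^+ k * (4 * (1 - (2 * N%:R)^-1) ^+ k)).
  rewrite mulrA ler_wpM2l ?exprn_ge0 //.
  by apply: le_trans (l1M1r _ _) (line_decay _ _ _); rewrite l1_corner.
by rewrite exprMn mulrA mulrC.
Qed.

(** Modulo the commutator subgroup, g is the product of the elementary
   matrices given by its superdiagonal; they are split off one at a time, the
   last one first. *)
Lemma step_decay_UT g t : g \in G ->
  l1 (step_law ^+ t * (pi * (1 - dirac R g))) <= d%:R * (4 * decay_rate ^+ t).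
Proof.
move=> gG.
suff: forall k, (k <= d)%N -> forall g, g \in G ->
    (forall c : 'I_d, (k <= c)%N -> mat g (src c) (tgt c) = 0) ->
    l1 (step_law ^+ t * (pi * (1 - dirac R g))) <= k%:R * (4 * decay_rate ^+ t).
  move/(_ d (leqnn d) g gG); apply => c le_dc.
  by have := leq_trans (ltn_ord c) le_dc; rewrite ltnn.
elim=> [_|k IH lt_kd] {gG} g gG g0.
  rewrite mulrBr mulr1 unifm_mulr ?subrr ?mulr0 ?l1_0 ?mul0r //.
  by apply: corner_superdiag => // c; apply: g0.
pose c := Ordinal lt_kd; pose y := mat g (src c) (tgt c).
have -> : g = (g * elt c (- y) * elt c y)%g.
  rewrite -mulgA -eltD addNr -[LHS]mulg1; congr (_ * _)%g.
  by apply: (mulgI (elt c 0)); rewrite -eltD addr0 mulg1.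
rewrite mulrA; apply: le_trans (l1_1BdiracM _ _ _) _; rewrite -!mulrA.
rewrite -[k.+1%:R]natr1 [leRHS]mulrDl mul1r.
apply: lerD; last exact: step_decay.
have eG z : elt c z \in G by apply: elt_UT.
apply: IH (ltnW lt_kd) _ (groupM gG (eG _)) _ => c' le_kc'.
rewrite superdiagM // elt_superdiag; have [->|ne] := eqVneq c' c.
  by rewrite mulr1n subrr.
rewrite mulr0n addr0 g0 // ltn_neqAle le_kc' andbT.
by apply: contraNneq ne => kc'; apply/eqP/val_inj.
Qed.

Lemma step_unif t : step_law ^+ t * U = U.
Proof.
elim: t => [|t IH]; first by rewrite mul1r.
rewrite exprSr -mulrA [step_law * U](_ : _ = U) //.
have [sQ _] := central_step.
apply: (supp_mulr sQ); last by move=> g gG; apply: unifm_mull.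
by rewrite mass_step.
Qed.

(** The first half of the distance, q ^+ t (1 - pi), is controlled by the
   coupon collector, whose rate 1 - 1/d is smaller than the rate of the
   second half, q ^+ t pi (1 - U). The latter reduces to translations by
   elements of G, because 1 - U has mass zero. *)
Theorem step_law_bound t :
  l1 (step_law ^+ t - U) <= 10 * d%:R * decay_rate ^+ t.
Proof.
have rate0 := decay_rate_ge0.
have piU : pi * U = U.
  apply: (supp_mulr (@supp_unifm _ _ _) (mass_unifm _ (group1 _))) => g gK.
  by rewrite unifm_mull //; apply: (subsetP (corner_sub d)).
have -> : step_law ^+ t - U = step_law ^+ t * (1 - pi) + step_law ^+ t * pi * (1 - U).
  by rewrite !mulrBr !mulr1 -mulrA piU step_unif addrA subrK.
have l1B2 (f : A) : l1 f <= 1 -> l1 (1 - f) <= 2.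
  by move=> f1; apply: le_trans (l1D _ _) _; rewrite l1N l1_1 lerD2l.
have B1 : l1 (step_law ^+ t * (1 - pi)) <= 2 * d%:R * decay_rate ^+ t.
  apply: le_trans (coupon_collector t d_gt0 _ l1_coord (enum_uniq _) coord_prod_pi) _.
    move=> i j; apply: central_comm; first exact: central_coord.
    by case: (central_coord j).
  rewrite size_enum_ord [leRHS]mulrAC -[leRHS]mulrA mulrC.
  apply: ler_pM; rewrite ?l1_ge0 ?l1B2 ?l1_corner //.
    rewrite mulr_ge0 ?exprn_ge0 // subr_ge0.
    by rewrite invf_le1 ?ler1n ?ltr0n.
  rewrite mulrC ler_wpM2r //; apply: lerXn2r; rewrite ?nnegrE //.
    by rewrite subr_ge0 invf_le1 ?ler1n ?ltr0n.
  rewrite lerD2l lerN2 lef_pV2 ?posrE -?natrM ?ltr0n ?muln_gt0 ?N_gt0 //.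
  by rewrite ler_nat leq_pmull // muln_gt0.
have B2 : l1 (step_law ^+ t * pi * (1 - U)) <= 8 * d%:R * decay_rate ^+ t.
  apply: le_trans (l1_mull_mass0 (X := G) (e := d%:R * (4 * decay_rate ^+ t)) _ _ _) _.
  - by apply: suppB; [apply: supp1 | apply: supp_unifm].
  - by rewrite massD massN (mass_unifm _ (group1 _)) -dirac1 mass_dirac subrr.
  - by move=> g gG; rewrite -mulrA step_decay_UT.
  have := l1B2 U; rewrite (l1_unifm _ (group1 _)) => /(_ (lexx _)) U2.
  rewrite [leRHS](_ : _ = d%:R * (4 * decay_rate ^+ t) * 2); last by ring.
  by rewrite ler_wpM2l // !mulr_ge0 ?exprn_ge0.
apply: le_trans (l1D _ _) _; apply: le_trans (lerD B1 B2) _.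
by rewrite -!mulrDl -natrD.
Qed.

End ClassWalk.

End UnitriangularGroup.

(** * The transition probabilities as powers in the group algebra *)
Lemma sum_seq4 (V : nmodType) (I : Type) (f : I -> V) i j k l :
  \sum_(x <- [:: i; j; k; l]) f x = f i + f j + f k + f l.
Proof. by rewrite !big_cons big_nil addr0 !addrA. Qed.

Section KernelIteration.
Variables (R : realFieldType) (gT : finGroupType) (G : {group gT}).
Variables (q : galg R gT) (step : gT -> gT -> R).
Hypothesis supp_q : supp G q.
Hypothesis stepE : forall x y, step x y = q (x^-1 * y)%g.

(** Since q is supported on G, the intermediate points w = x z range over G
   exactly when z does, so that the sum over w is a convolution. *)
Lemma iter_kernelE t x y : x \in G ->
  iter t (fun K x y => \sum_(w in G) K w y * step x w) step x y =
    (q ^+ t.+1) (x^-1 * y)%g.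
Proof.
elim: t x => [|t IH] x xG; first by rewrite /= expr1.
rewrite iterS exprS galg_mulE [RHS](bigID (mem G)) /=.
rewrite [X in _ = _ + X]big1 ?addr0; last by move=> z /supp_q ->; rewrite mul0r.
rewrite [RHS](reindex_inj (mulgI x^-1%g)); apply: eq_big => [z|z zG].
  by rewrite groupMl ?groupV.
by rewrite IH // stepE mulrC invMg invgK -mulgA mulKVg.
Qed.

Lemma sum_shift_unifm t x : x \in G ->
  \sum_(g in G) `|(q ^+ t) (x^-1 * g)%g - (#|G|%:R)^-1| =
    l1 (q ^+ t - unifm R G).
Proof.
move=> xG; rewrite /l1 [RHS](bigID (mem G)) /= [X in _ = _ + X]big1 ?addr0.
  rewrite [RHS](reindex_inj (mulgI x^-1%g)); apply: eq_big => [z|z zG].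
    by rewrite groupMl ?groupV.
  by rewrite !ffunE groupMl ?groupV // zG mul1r.
move=> z zG; rewrite !ffunE (suppX t supp_q zG) (negPf zG) mul0r subr0.
by rewrite normr0.
Qed.

End KernelIteration.

(** * The walk on the group of unitriangular matrices *)
Section MatrixWalk.

Variables (R : realType) (n p : nat).
Hypothesis p_pr : prime p.
Hypothesis p_odd : odd p.
Hypothesis n_ge2 : (2 <= n)%N.
Local Notation F := 'F_p.
Local Notation gT := {'GL_n(p)}.
Local Notation G := (UT n p).

Lemma GLval1 : GLval (1%g : gT) = 1%:M. Proof. by []. Qed.
Lemma GLvalM (g h : gT) : GLval (g * h)%g = GLval g *m GLval h.
Proof. by []. Qed.

Lemma UT_unitri (g : gT) : g \in G <-> unitri (GLval g).
Proof. by split=> /UT_setP. Qed.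

Lemma unitri_GLval (A : 'M[F]_n.-1.+1) : unitri A -> exists g : gT, GLval g = A.
Proof.
move=> uA; have uU : A \is a GRing.unit.
  rewrite -[_ \is a _]/(A \in unitmx) unitmxE -det_tr det_trig.
    by rewrite big1 ?unitr1 // => i _; rewrite mxE uA ?eqxx.
  apply/is_trig_mxP=> i j lt_ij; rewrite mxE (uA _ _ (ltnW lt_ij)).
  have /negPf -> : j != i by apply: contraTneq lt_ij => ->; rewrite ltnn.
  by [].
by exists (FinRing.unit _ uU).
Qed.

Local Notation Q := (@step_law F gT G n.-1 (@elem_UT n p) R (jumps R p)).
Local Notation a := (jump R p).
Local Notation m := (Num.truncn (Num.sqrt (p%:R : R))).

Lemma truncn_sqrt_bounds : (m ^ 2 <= p < m.+1 ^ 2)%N.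
Proof.
have p0 : 0 <= p%:R :> R by [].
have /andP[le_m lt_m] := truncn_itv (sqrtr_ge0 (p%:R : R)).
move: (Num.truncn _) le_m lt_m => k le_k lt_k.
rewrite -!(ltr_nat R) -!(ler_nat R) !natrX -(sqr_sqrtr p0).
have s0 : 0 <= Num.sqrt (p%:R : R) := sqrtr_ge0 _.
by rewrite ler_pXn2r ?ltr_pXn2r ?nnegrE // le_k lt_k.
Qed.

Lemma truncn_sqrt_gt0 : (0 < m)%N.
Proof.
have /andP[_] := truncn_sqrt_bounds; case: m => // /=.
by have := prime_gt1 p_pr; case: (p) => [|[|]].
Qed.

Lemma jump_bounds : (m <= a <= m.+1)%N.
Proof.
by rewrite /jump; move: m => k /=; case: ifP => _; rewrite leqnn leqnSn.
Qed.

Lemma jump_lt : (0 < a < p)%N.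
Proof.
have /andP[le_mp _] := truncn_sqrt_bounds; have m0 := truncn_sqrt_gt0.
apply/andP; split; first by have /andP[le_ma _] := jump_bounds; apply: leq_trans m0 le_ma.
have p1 := prime_gt1 p_pr.
rewrite /jump; move: m le_mp m0 => k le_kp k0; case: ifP => [_|k_even].
  have [k1|k1] := leqP k 1; first by apply: leq_ltn_trans k1 p1.
  by apply: leq_trans le_kp; rewrite -{1}[k]muln1 ltn_pmul2l.
(* Here jump is k + 1 with k even and positive, and k + 1 < k ^ 2 <= p. *)
case: k k0 k_even le_kp => [|[|k]] // _ _ le_kp; apply: leq_trans le_kp.
by rewrite -mulnn !mulSn; lia.
Qed.

Lemma jumps_neq0 (y : F) : y \in jumps R p -> y != 0.
Proof.
have nz k : (0 < k < p)%N -> k%:R != 0 :> F.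
  case/andP=> k0 kp; rewrite -(dvdn_pcharf (pchar_Fp p_pr)).
  by rewrite gtnNdvd.
rewrite !inE => /or4P[]/eqP->; rewrite ?oppr_eq0 ?oner_neq0 //.
  exact/nz/jump_lt.
exact/nz/jump_lt.
Qed.

Lemma mat_elem_UT c y :
  GLval (@elem_UT n p c y) = 1%:M + y *: delta_mx (src c) (tgt c).
Proof. by []. Qed.

Lemma walk_stepE (x w : gT) : walk_step R x w = Q (x^-1 * w)%g.
Proof.
rewrite /walk_step; move: (x^-1 * w)%g => g.
have cardC (c : 'I_n.-1) (y : F) : y \in jumps R p -> #|@elem_class n p c y| = (p ^ (n - 2))%N.
  move=> /jumps_neq0 y0; rewrite /elem_class.
  have := card_class_elt GLval1 GLvalM val_inj UT_unitri unitri_GLval mat_elem_UT c y0.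
  rewrite card_Fp // -subn1 -(subn1 n) -subnDA. exact.
rewrite -natrX !invfM -!mulrA mulrCA galg_scaleE galg_sumE; congr (_ * _).
rewrite mulrA big_distrr; apply: eq_bigr => c _ /=.
rewrite galg_scaleE galg_sumE -mulrA; congr (_ * _).
rewrite big_distrr; apply: eq_big_seq => y yj /=.
rewrite ffunE mulrC; congr (_ * _%:R^-1).
by apply/esym; apply: (cardC c y yj).
Qed.

Lemma line_lawE c : line_law (@elem_UT n p) R (jumps R p) c =
  four_step R (elem_UT c) a%:R.
Proof. by rewrite /line_law [\sum_(y <- _) _]sum_seq4. Qed.

Lemma walk_l1_bound t : exists N, [/\ (0 < N)%N, (N <= 1152 * p)%N &
  l1 (Q ^+ t - unifm R G) <= 10 * n.-1%:R * decay_rate n.-1 R N ^+ t].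
Proof.
have m0 := truncn_sqrt_gt0; have mp := truncn_sqrt_bounds.
have N0 : (0 < 1152 * m ^ 2)%N by rewrite muln_gt0 expn_gt0 m0.
exists (1152 * m ^ 2)%N; split=> //; first by rewrite leq_mul2l /=; case/andP: mp.
apply: (step_law_bound GLval1 GLvalM val_inj UT_unitri unitri_GLval mat_elem_UT
  jumps_neq0) => //.
- by rewrite -ltnS prednK // ltnW.
move=> c y; rewrite line_lawE.
apply: (four_step_half _ _ p_pr p_odd m0 mp jump_bounds).
exact: (eltD GLvalM val_inj mat_elem_UT).
Qed.

Lemma step_l1_le2 t : l1 (Q ^+ t - unifm R G) <= 2.
Proof.
apply: le_trans (l1D _ _) _; rewrite l1N (l1_unifm _ (group1 _)) lerD2r.
apply: l1X; apply: l1_step => //.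
by rewrite -ltnS prednK // ltnW.
Qed.

Lemma walk_tvE t x : (0 < t)%N -> x \in G ->
  2 * tv_dist (walk R t x) (@unif R n p) = l1 (Q ^+ t - unifm R G).
Proof.
move=> t0 xG; rewrite /tv_dist mulVKf ?pnatr_eq0 //.
have sQ : supp G Q.
  by have [] := central_step UT_unitri mat_elem_UT R (jumps R p).
rewrite -(sum_shift_unifm sQ t xG).
apply: eq_bigr => g gG; rewrite /walk /unif.
by rewrite (iter_kernelE sQ walk_stepE _ _ xG) prednK.
Qed.

End MatrixWalk.

(** * The total variation bound *)
Lemma exp1B_le_expR (R : realType) (u : R) t : 0 <= 1 - u -> (1 - u) ^+ t <= expR (- (t%:R * u)).
Proof.
move=> u1; rewrite -mulrN expRM_natl; apply: lerXn2r; rewrite ?nnegrE ?expR_ge0 //.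
exact: expR_ge1Dx.
Qed.

Lemma ln_ge_half (R : realType) n : (2 <= n)%N -> 2^-1 <= ln (n%:R : R).
Proof.
move=> n2; have n0 : 0 < n%:R :> R by rewrite ltr0n ltnW.
rewrite -ler_expR lnK ?posrE //; apply: (@le_trans _ _ 2); last by rewrite ler_nat.
have := expR_ge1Dx (- 2^-1 : R); rewrite expRN => h.
rewrite -[expR _]invrK -[leRHS]invrK lef_pV2 ?posrE ?invr_gt0 ?expR_gt0 //.
by apply: le_trans h; lra.
Qed.

Theorem theorem2 (R : realType) :
  exists alpha beta : R,
    [/\ 0 < alpha, 0 < beta &
      forall p : nat, prime p -> odd p ->
      forall n : nat, (2 <= n)%N ->
      forall c : R, 0 < c ->
      forall t : nat, (0 < t)%N ->
        t%:R = c * beta * p%:R * n%:R * ln n%:R ->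
      forall x : {'GL_n(p)}, x \in UT n p ->
        4 * tv_dist (walk R t x) (@unif R n p) ^+ 2 <= alpha * expR (- c)].
Proof.
(* The norm decays like 10 n expR (- t / (2 N n)) with N <= 1152 p: hence
   100 = 10 ^ 2, and beta = 2 * 2304 makes the exponent at most - 2 c ln n. *)
exists 100, 4608; split; rewrite ?ltr0n //.
move=> p p_pr p_odd n n_ge2 c c0 t t0 tE x xG.
have -> : 4 * tv_dist (walk R t x) (@unif R n p) ^+ 2 =
    (2 * tv_dist (walk R t x) (@unif R n p)) ^+ 2.
  by ring.
rewrite walk_tvE //.
have [N [N0 leN le_l]] := walk_l1_bound R p_pr p_odd n_ge2 t; move: le_l.
have := step_l1_le2 R p n_ge2 t.
have := l1_ge0 (step_law (UT n p) (@elem_UT n p) R (jumps R p) ^+ t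
  - unifm R (UT n p)).
move: (l1 _) => l l0 l2 le_l.
(* For c < 1 the trivial bound 2 ^ 2 is enough, as expR (- 1) >= 1/4. *)
have [c1|c1] := ltP c 1.
  have : expR (- 2^-1) ^+ 2 <= expR (- c).
    by rewrite -expRM_natl ler_expR; lra.
  have := expR_ge1Dx (- 2^-1 : R); move: (expR _) (expR _) => u v; nra.
have p0 : 0 < p%:R :> R by rewrite ltr0n prime_gt0.
have n0 : 0 < n%:R :> R by rewrite ltr0n ltnW.
have d0 : (0 < n.-1)%N by rewrite -ltnS prednK // ltnW.
have L0 := ln_ge_half R n_ge2; set L := ln _ in tE L0.
have tu : 2 * c * L <= t%:R * (2 * N%:R * n.-1%:R)^-1.
  rewrite ler_pdivlMr -?natrM ?ltr0n ?muln_gt0 ?N0 // tE.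
  have : (2 * N * n.-1)%N%:R <= 2304 * p%:R * n%:R :> R.
    have le2N : (2 * N <= 2304 * p)%N.
      by rewrite (_ : 2304 = 2 * 1152)%N // -mulnA leq_mul2l.
    by rewrite -!natrM ler_nat; apply: leq_mul le2N (leq_pred n).
  have : 0 <= 2 * c * L by apply: mulr_ge0; lra.
  move=> cL leM; apply: le_trans (ler_wpM2l cL leM) _.
  by rewrite le_eqVlt; apply/orP; left; apply/eqP; ring.
(* The factor n = expR L is compensated by half of the decay. *)
have : l <= 10 * expR (- (c * L)).
  apply: le_trans le_l _; rewrite -mulrA ler_wpM2l //.
  apply: (@le_trans _ _ (expR L * expR (- (2 * c * L)))).
    apply: ler_pM => //; first by rewrite exprn_ge0 // decay_rate_ge0.
      by rewrite lnK ?posrE // ler_nat leq_pred.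
    apply: le_trans (exp1B_le_expR _ _) _; first exact: decay_rate_ge0.
    by rewrite ler_expR lerN2.
  rewrite -expRD ler_expR; nra.
move=> {}le_l; apply: (@le_trans _ _ ((10 * expR (- (c * L))) ^+ 2)).
  by apply: lerXn2r; rewrite ?nnegrE // mulr_ge0 ?expR_ge0.
rewrite exprMn (_ : 10 ^+ 2 = 100) -?natrX // ler_wpM2l //.
by rewrite -expRM_natl ler_expR; nra.
Qed.
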